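(* Let $\alpha\in(0,1]$, $\sigma\in(0,1)$, let $k\ge1$ be an integer such that $e_{k-1}(q^{\alpha})\neq0$ for all $q\in\mathbb E$, and let $\mathbf i\in\mathbb S^2$. Then $(\mathfrak D^{\sigma}_{\alpha,k,\mathbf i},\|\cdot\|_{\mathfrak D^{\sigma}_{\alpha,k,\mathbf i}})$ is a normed quaternionic right-module; that is, it is a right $\mathbb H$-module, $\|f\|\ge0$ with $\|f\|=0$ only for $f\equiv0$, $\|fa\|=\|f\|\,|a|$ for all $a\in\mathbb H$, and $\|f+g\|\le\|f\|+\|g\|$.
   Context: $\mathbb H$ is the skew field of quaternions, $\mathbb S^2$ the sphere of purely imaginary unit quaternions, $\mathbb C(\mathbf i)=\{x+\mathbf iy: x,y\in\mathbb R\}$ for $\mathbf i\in\mathbb S^2$, $\mathbb B=\{q\in\mathbb H:|q|<1\}$, $\mathbb E=\mathbb B\setminus(-1,0]$ where $(-1,0]$ is the set of real quaternions $q_0$ with $-1<q_0\le0$, and $\mathbb E_{\mathbf i}=\mathbb E\cap\mathbb C(\mathbf i)$. A real differentiable function $f:\mathbb E\to\mathbb H$ is slice regular if $\left(\frac{\partial}{\partial x}+\mathbf i\frac{\partial}{\partial y}\right)f|_{\mathbb E_{\mathbf i}}=0$ on $\mathbb E_{\mathbf i}$ for every $\mathbf i\in\mathbb S^2$; $\mathcal{SR}(\mathbb E)$ is the right $\mathbb H$-module of such functions. For $q\in\mathbb E$, $q^{\alpha}$ is the principal power computed in a complex plane $\mathbb C(I)$, $I\in\mathbb S^2$, containing $q$,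 and $e_k(q)=\sum_{n=0}^k\frac{q^n}{n!}$. For $f\in\mathcal{SR}(\mathbb E)$ and $z\in\mathbb E_{\mathbf i}$, $$\frac{d^{\sigma}}{dq_{\alpha,k,\mathbf i}}f|_{\mathbb E_{\mathbf i}}(z)=(1-\sigma)f(z)+\sigma\lim_{\zeta\to z,\ \zeta\in\mathbb E_{\mathbf i}}\left(e_k(z^{\alpha})-e_k(\zeta^{\alpha})\right)^{-1}\left(f(z)-f(\zeta)\right).$$ $\mathfrak D^{\sigma}_{\alpha,k,\mathbf i}$ is the set of all $f\in\mathcal{SR}(\mathbb E)$ with $$\|f\|^2_{\mathfrak D^{\sigma}_{\alpha,k,\mathbf i}}:=\alpha\left|f\left(\tfrac12\right)\right|^2+\int_{\mathbb E_{\mathbf i}}\left|\frac{d^{\sigma}}{dq_{\alpha,k,\mathbf i}}f|_{\mathbb E_{\mathbf i}}(z)\right|^2d_z\mu<\infty,$$ where $\mu$ is Lebesgue area measure on $\mathbb C(\mathbf i)$ and $|\cdot|$ is the quaternionic modulus. *)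

(* Defs.v *)
From HB Require Import structures.
From mathcomp Require Import all_boot all_order all_algebra.
From mathcomp Require Import ring lra.
From mathcomp Require Import all_classical all_reals all_analysis.

Set Implicit Arguments.
Unset Strict Implicit.
Unset Printing Implicit Defensive.

Import Order.TTheory GRing.Theory Num.Theory.
Import numFieldNormedType.Exports.

Local Open Scope classical_set_scope.
Local Open Scope ring_scope.

(* [Quat a b c d] is a + b i + c j + d k, with i j = k. *)
Record quat (R : Type) := Quat { qr : R; qi : R; qj : R; qk : R }.

Section QuatAlgebra.
Variable R : realType.
Implicit Types p q : quat R.

Definition tuple_of_quat q := (qr q, qi q, qj q, qk q).
Definition quat_of_tuple (t : R * R * R * R) :=
  let: (a, b, c, d) := t in Quat a b c d.

Lemma tuple_of_quatK : cancel tuple_of_quat quat_of_tuple.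
Proof. by case. Qed.

HB.instance Definition _ := Choice.copy (quat R) (can_type tuple_of_quatK).

Definition quat_zero : quat R := Quat 0 0 0 0.
Definition quat_one : quat R := Quat 1 0 0 0.
Definition quat_opp q := Quat (- qr q) (- qi q) (- qj q) (- qk q).
Definition quat_add p q :=
  Quat (qr p + qr q) (qi p + qi q) (qj p + qj q) (qk p + qk q).
Definition quat_mul p q :=
  Quat (qr p * qr q - qi p * qi q - qj p * qj q - qk p * qk q)
       (qr p * qi q + qi p * qr q + qj p * qk q - qk p * qj q)
       (qr p * qj q - qi p * qk q + qj p * qr q + qk p * qi q)
       (qr p * qk q + qi p * qj q - qj p * qi q + qk p * qr q).
Definition quat_scale (a : R) q :=
  Quat (a * qr q) (a * qi q) (a * qj q) (a * qk q).
Definition quat_sqnorm q := qr q ^+ 2 + qi q ^+ 2 + qj q ^+ 2 + qk q ^+ 2.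
Definition quat_inv q :=
  quat_scale (quat_sqnorm q)^-1 (Quat (qr q) (- qi q) (- qj q) (- qk q)).
Definition quat_norm q := Num.sqrt (quat_sqnorm q).

Lemma quat_addA : associative quat_add.
Proof. by move=> p q r; rewrite /quat_add /= !addrA. Qed.
Lemma quat_addC : commutative quat_add.
Proof. by move=> p q; congr Quat; rewrite addrC. Qed.
Lemma quat_add0 : left_id quat_zero quat_add.
Proof. by case=> a b c d; rewrite /quat_add /= !add0r. Qed.
Lemma quat_addN : left_inverse quat_zero quat_opp quat_add.
Proof. by move=> p; rewrite /quat_add /= !addNr. Qed.

HB.instance Definition _ :=
  GRing.isZmodule.Build (quat R) quat_addA quat_addC quat_add0 quat_addN.

Lemma quat_mulA : associative quat_mul.
Proof. by move=> p q r; congr Quat => /=; ring. Qed.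
Lemma quat_mul1 : left_id quat_one quat_mul.
Proof. by case=> a b c d; congr Quat => /=; ring. Qed.
Lemma quat_mulr1 : right_id quat_one quat_mul.
Proof. by case=> a b c d; congr Quat => /=; ring. Qed.
Lemma quat_mulDl : left_distributive quat_mul quat_add.
Proof. by move=> p q r; congr Quat => /=; ring. Qed.
Lemma quat_mulDr : right_distributive quat_mul quat_add.
Proof. by move=> p q r; congr Quat => /=; ring. Qed.
Lemma quat_one_neq0 : quat_one != 0.
Proof. by apply/eqP => -[] /eqP; rewrite oner_eq0. Qed.

HB.instance Definition _ := GRing.Zmodule_isNzRing.Build (quat R)
  quat_mulA quat_mul1 quat_mulr1 quat_mulDl quat_mulDr quat_one_neq0.

Lemma quat_scaleA a b q : quat_scale a (quat_scale b q) = quat_scale (a * b) q.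
Proof. by congr Quat => /=; ring. Qed.
Lemma quat_scale1 : left_id 1 quat_scale.
Proof. by case=> a b c d; congr Quat => /=; ring. Qed.
Lemma quat_scaleDr : right_distributive quat_scale +%R.
Proof. by move=> a p q; congr Quat => /=; ring. Qed.
Lemma quat_scaleDl q : {morph quat_scale^~ q : a b / a + b}.
Proof. by move=> a b; congr Quat => /=; ring. Qed.

HB.instance Definition _ := GRing.Zmodule_isLmodule.Build R (quat R)
  quat_scaleA quat_scale1 quat_scaleDr quat_scaleDl.

Lemma quat_scaleAl (a : R) p q : a *: (p * q) = (a *: p) * q.
Proof. by congr Quat => /=; ring. Qed.
HB.instance Definition _ :=
  GRing.Lmodule_isLalgebra.Build R (quat R) quat_scaleAl.

Lemma quat_scaleAr (a : R) p q : a *: (p * q) = p * (a *: q).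
Proof. by congr Quat => /=; ring. Qed.
HB.instance Definition _ :=
  GRing.Lalgebra_isAlgebra.Build R (quat R) quat_scaleAr.

Lemma quat_sqnorm_ge0 q : 0 <= quat_sqnorm q.
Proof. by rewrite !addr_ge0 ?sqr_ge0. Qed.

Lemma quat_sqnorm_eq0 q : (quat_sqnorm q == 0) = (q == 0).
Proof.
apply/idP/eqP => [|->]; last by rewrite /quat_sqnorm /= expr0n /= !addr0.
case: q => a b c d; rewrite /quat_sqnorm /=.
rewrite !paddr_eq0 ?addr_ge0 ?sqr_ge0// !sqrf_eq0.
by move=> /andP[/andP[/andP[/eqP-> /eqP->] /eqP->] /eqP->].
Qed.

Lemma quat_mulVr : {in [pred q : quat R | q != 0], left_inverse 1 quat_inv *%R}.
Proof.
move=> q; rewrite inE -quat_sqnorm_eq0 => q0.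
by congr Quat => /=; move: q0; rewrite /quat_sqnorm => q0; field.
Qed.
Lemma quat_mulrV : {in [pred q : quat R | q != 0], right_inverse 1 quat_inv *%R}.
Proof.
move=> q; rewrite inE -quat_sqnorm_eq0 => q0.
by congr Quat => /=; move: q0; rewrite /quat_sqnorm => q0; field.
Qed.
Lemma quat_unitP p q : q * p = 1 /\ p * q = 1 -> p \in [pred q : quat R | q != 0].
Proof.
move=> [+ _]; rewrite inE; apply: contra_eqN => /eqP->.
by rewrite mulr0 eq_sym oner_eq0.
Qed.
Lemma quat_inv_out : {in [predC [pred q : quat R | q != 0]], quat_inv =1 id}.
Proof.
move=> q; rewrite !inE negbK => /eqP->.
by congr Quat => /=; rewrite ?oppr0 mulr0.
Qed.

HB.instance Definition _ := GRing.NzRing_hasMulInverse.Build (quat R)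
  quat_mulVr quat_mulrV quat_unitP quat_inv_out.

Lemma quat_unitE q : (q \is a GRing.unit) = (q != 0).
Proof. by []. Qed.

Lemma quat_normD p q : quat_norm (p + q) <= quat_norm p + quat_norm q.
Proof.
have Np := sqrtr_ge0 (quat_sqnorm p); have Nq := sqrtr_ge0 (quat_sqnorm q).
rewrite /quat_norm -[leRHS]ger0_norm ?addr_ge0// -sqrtr_sqr.
apply: ler_wsqrtr.
rewrite sqrrD !sqr_sqrtr ?quat_sqnorm_ge0// -sqrtrM ?quat_sqnorm_ge0//.
pose d := qr p * qr q + qi p * qi q + qj p * qj q + qk p * qk q.
have -> : quat_sqnorm (p + q) = quat_sqnorm p + d *+ 2 + quat_sqnorm q.
  by rewrite /quat_sqnorm /d /=; ring.
rewrite lerD2r lerD2l lerMn2r /= (le_trans (ler_norm d))// -sqrtr_sqr.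
apply: ler_wsqrtr; rewrite -subr_ge0 /d /quat_sqnorm.
have -> : forall a b c e a' b' c' e' : R,
  (a ^+ 2 + b ^+ 2 + c ^+ 2 + e ^+ 2) * (a' ^+ 2 + b' ^+ 2 + c' ^+ 2 + e' ^+ 2)
  - (a * a' + b * b' + c * c' + e * e') ^+ 2 =
  (a * b' - b * a') ^+ 2 + (a * c' - c * a') ^+ 2 + (a * e' - e * a') ^+ 2 +
  (b * c' - c * b') ^+ 2 + (b * e' - e * b') ^+ 2 + (c * e' - e * c') ^+ 2.
  by move=> *; ring.
by rewrite !addr_ge0 ?sqr_ge0.
Qed.

Lemma quat_normZ (a : R) q : quat_norm (a *: q) = `|a| * quat_norm q.
Proof.
rewrite /quat_norm -sqrtr_sqr -sqrtrM ?sqr_ge0//; congr Num.sqrt.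
by rewrite /quat_sqnorm /=; ring.
Qed.

Lemma quat_norm_eq0 q : quat_norm q = 0 -> q = 0.
Proof.
move=> /eqP; rewrite sqrtr_eq0 => q0; apply/eqP.
by rewrite -quat_sqnorm_eq0 eq_le q0 quat_sqnorm_ge0.
Qed.

HB.instance Definition _ := @Lmodule_isNormed.Build R (quat R)
  quat_norm quat_normD quat_normZ quat_norm_eq0.

Lemma quat_normE q : `|q| = quat_norm q.
Proof. by []. Qed.

Lemma quat_normM p q : `|p * q| = `|p| * `|q|.
Proof.
rewrite !quat_normE /quat_norm -sqrtrM ?quat_sqnorm_ge0//; congr Num.sqrt.
by rewrite /quat_sqnorm /=; ring.
Qed.

End QuatAlgebra.

Section Slices.
Variable R : realType.
Implicit Types (q I : quat R) (x y : R).

Definition imag q : quat R := Quat 0 (qi q) (qj q) (qk q).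

Definition imag_sphere : set (quat R) := [set q | qr q = 0 /\ `|q| = 1].

(* The point x + I y of C(I), for w = (x, y). *)
Definition slice_pt I (w : R * R) : quat R := w.1%:A + w.2 *: I.

Definition cplane I : set (quat R) := range (slice_pt I).

Definition Bdom : set (quat R) := [set q | `|q| < 1].

Definition slit : set (quat R) := [set x%:A | x in [set x | -1 < x <= 0]].

Definition Edom : set (quat R) := Bdom `\` slit.

Definition Eslice I : set (quat R) := Edom `&` cplane I.

(* Some I in the sphere with q in C(I): it is the normalized imaginary part of q,
   and an arbitrary imaginary unit when q is real. *)
Definition imag_unit q : quat R :=
  if imag q == 0 then Quat 0 1 0 0 else `|imag q|^-1 *: imag q.

(* The principal power in C(I), I := imag_unit q: here q = x + I y with x = qr q
   and y = `|imag q| >= 0, so the principal argument of q is acos (x / `|q|).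
   Lemma [qpow_polar] shows that the value is the principal power computed in any
   plane C(I) containing q. *)
Definition qpow (a : R) q : quat R :=
  let t := acos (qr q / `|q|) in
  (`|q| `^ a) *: slice_pt (imag_unit q) (cos (a * t), sin (a * t)).

Lemma slice_ptE I x y : qr I = 0 ->
  slice_pt I (x, y) = Quat x (y * qi I) (y * qj I) (y * qk I).
Proof. by move=> I0; congr Quat => /=; rewrite ?I0; ring. Qed.

Lemma imag_unitP q : imag_sphere (imag_unit q) /\
  q = slice_pt (imag_unit q) (qr q, `|imag q|).
Proof.
rewrite /imag_unit; case: eqVneq => [q0|q0].
  split; first by split=> //=; rewrite quat_normE /quat_norm /quat_sqnorm /=
    !expr0n /= !addr0 add0r expr1n sqrtr1.
  rewrite q0 normr0 slice_ptE// !mul0r.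
  by case: q q0 => a b c d [] /= -> -> ->.
have n0 : `|imag q| != 0 by rewrite normr_eq0.
split; first by split; rewrite /= ?mulr0// normrZ normfV normr_id mulVf.
rewrite slice_ptE /= ?mulr0// !mulrA divff// !mul1r.
by case: q {q0 n0}.
Qed.

Lemma qpow_polar (a : R) I (r t : R) : imag_sphere I -> 0 < r -> - pi < t < pi ->
  qpow a (r *: slice_pt I (cos t, sin t)) =
  (r `^ a) *: slice_pt I (cos (a * t), sin (a * t)).
Proof.
move=> [I0 I1] r0 /andP[t1 t2]; set q := r *: _.
have IE : qi I ^+ 2 + qj I ^+ 2 + qk I ^+ 2 = 1.
  have : quat_sqnorm I = 1.
    by rewrite -[LHS]sqr_sqrtr ?quat_sqnorm_ge0// -/(quat_norm I) -quat_normE I1 expr1n.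
  by rewrite /quat_sqnorm I0 expr0n /= add0r.
have qE : q = Quat (r * cos t) (r * (sin t * qi I)) (r * (sin t * qj I))
                   (r * (sin t * qk I)) by rewrite /q slice_ptE.
have nq : `|q| = r.
  rewrite quat_normE /quat_norm (_ : quat_sqnorm q = r ^+ 2).
    by rewrite sqrtr_sqr gtr0_norm.
  rewrite qE /quat_sqnorm /=.
  transitivity (r ^+ 2 * (cos t ^+ 2 +
    sin t ^+ 2 * (qi I ^+ 2 + qj I ^+ 2 + qk I ^+ 2))); first by ring.
  by rewrite IE mulr1 cos2Dsin2 mulr1.
have imE : imag q = (r * sin t) *: I.
  by rewrite qE; congr Quat; rewrite /= ?I0 ?mulr0 ?mulrA.
have Iz : I != 0 by rewrite -normr_eq0 I1 oner_eq0.
rewrite /qpow nq; congr (_ *: _).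
have -> : qr q / r = cos t by rewrite qE /= mulrAC divff ?mul1r// gt_eqF.
have [s0|s0|s0] := ltrgtP (sin t) 0.
- have t0 : t < 0.
    rewrite ltNge; apply/negP => t0; move: s0; apply/negP; rewrite -leNgt.
    by apply: sin_ge0_pi; rewrite t0 ltW.
  have -> : acos (cos t) = - t.
    by rewrite -cosN cosK// in_itv/= oppr_ge0 ltW//= lerNl ltW.
  have -> : imag_unit q = - I.
    rewrite /imag_unit imE scaler_eq0 (negPf Iz) orbF mulf_eq0 (gt_eqF r0) /=.
    rewrite (lt_eqF s0) normrZ I1 mulr1 normrM (gtr0_norm r0) (ltr0_norm s0).
    rewrite scalerA mulrN invrN mulNr mulVf ?scaleN1r//.
    by rewrite mulf_neq0// ?(gt_eqF r0)// (lt_eqF s0).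
  by rewrite mulrN cosN sinN /slice_pt /= scaleNr scalerN opprK.
- have t0 : 0 < t.
    rewrite ltNge; apply/negP => t0; move: s0; apply/negP; rewrite -leNgt.
    by rewrite -oppr_ge0 -sinN; apply: sin_ge0_pi; rewrite oppr_ge0 t0 lerNl ltW.
  have -> : acos (cos t) = t by rewrite cosK// in_itv/= !ltW.
  have -> // : imag_unit q = I.
    rewrite /imag_unit imE scaler_eq0 (negPf Iz) orbF mulf_eq0 (gt_eqF r0) /=.
    rewrite (gt_eqF s0) normrZ I1 mulr1 normrM (gtr0_norm r0) (gtr0_norm s0).
    by rewrite scalerA mulVf ?scale1r// mulf_neq0// gt_eqF.
- have t0 : t = 0.
    have [t0|t0|//] := ltrgtP t 0.
      have : 0 < sin (- t) by apply: sin_gt0_pi; rewrite oppr_gt0 t0 ltrNl.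
      by rewrite sinN s0 oppr0 ltxx.
    have : 0 < sin t by apply: sin_gt0_pi; rewrite t0.
    by rewrite s0 ltxx.
  by rewrite t0 cos0 acos1 mulr0 sin0 /slice_pt /= !scale0r.
Qed.

Definition trunc_exp (k : nat) q : quat R := \sum_(n < k.+1) (n`!%:R)^-1 *: q ^+ n.

End Slices.

Arguments imag_sphere R : clear implicits.
Arguments Bdom R : clear implicits.
Arguments slit R : clear implicits.
Arguments Edom R : clear implicits.

Section SliceRegular.
Variable R : realType.

(* Right H-modules are left modules over the converse ring H^c; the functions from
   E to H form one, with a *: f being x |-> f x * a (Lemma [right_scaleE]). *)
Definition Efun : Type := Edom R -> (quat R)^c^o.

HB.instance Definition _ := GRing.Lmodule.copy Efun (Edom R -> (quat R)^c^o).

Implicit Types f : Efun.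

Lemma right_scaleE (a : (quat R)^c) f (x : Edom R) :
  (a *: f) x = ((f x : quat R) * (a : quat R))%R.
Proof. by []. Qed.

(* Extension by 0 off the open set E; only its values on E are ever relevant. *)
Definition Eext f : quat R -> quat R := 'valL_(0 : quat R) f.

Lemma EextE f (x : Edom R) : Eext f (set_val x) = f x.
Proof. exact: (congr1 (@^~ x) (valLK (0 : quat R) f)). Qed.

Definition slice_regular : set Efun := [set f |
  (forall q : quat R, Edom R q -> differentiable (Eext f) q) /\
  (forall I : quat R, imag_sphere R I -> forall x y : R, Edom R (slice_pt I (x, y)) ->
     derive1 (fun t : R => Eext f (slice_pt I (t, y))) x
     + I * derive1 (fun t : R => Eext f (slice_pt I (x, t))) y = 0)].

Variables (s a : R) (k : nat) (I : quat R).

Definition frac_deriv f (z : quat R) : quat R :=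
  (1 - s) *: Eext f z +
  s *: lim ((trunc_exp k (qpow a z) - trunc_exp k (qpow a zeta))^-1
              * (Eext f z - Eext f zeta) @[zeta --> within (Eslice I) z^']).

(* Area measure on C(I) is the product Lebesgue measure in the coordinates (x, y)
   of x + I y. *)
Definition Dsqnorm f : \bar R :=
  ((a * `|Eext f (2^-1)%:A| ^+ 2)%:E +
   \int[(@lebesgue_measure R) \x (@lebesgue_measure R)]_(w in
       [set w | Eslice I (slice_pt I w)])
     (`|frac_deriv f (slice_pt I w)| ^+ 2)%:E)%E.

Definition Dspace : set Efun :=
  [set f | slice_regular f /\ (Dsqnorm f < +oo)%E].

Definition Dnorm f : R := Num.sqrt (fine (Dsqnorm f)).

End SliceRegular.

(* The right-module axioms come from the ambient right module [V]; what is asserted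
   of [D] is that the operations restrict to it. *)
Definition normed_right_module (R : realType) (V : lmodType (quat R)^c)
    (D : set V) (N : V -> R) : Prop :=
  [/\ submod_closed [in D],
      forall f, D f -> 0 <= N f,
      forall f, D f -> N f = 0 -> f = 0,
      forall f (c : quat R), D f -> N ((c : (quat R)^c) *: f) = N f * `|c| &
      forall f g, D f -> D g -> N (f + g) <= N f + N g].

(* Main.v *)
From HB Require Import structures.
Require Import Defs.
From mathcomp Require Import all_boot all_order all_algebra.
From mathcomp Require Import ring lra.
From mathcomp Require Import all_classical all_reals all_analysis.
From mathcomp Require Import complex measurable_realfun.
Import Order.TTheory GRing.Theory Num.Theory.
Import numFieldNormedType.Exports.
Import ComplexField.Normc.
Local Open Scope classical_set_scope.
Local Open Scope ring_scope.

(** Only definiteness is deep: the other axioms follow from the right linearity of the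
    fractional derivative.

    Let f be slice regular. Real differentiability and the Cauchy-Riemann equation on C(i)
    give f a derivative f' along that plane, in the sense that
    f w - f z - (w - z) f'(z) = o(w - z), with the increment on the left
    ([slice_regular_sderiv]). The function z |-> e_k (z^alpha) is holomorphic on the slit disc
    with derivative alpha z^(alpha - 1) e_(k-1) (z^alpha), which has no zero by the hypothesis
    on e_(k-1). Hence the limit in the definition exists, and the fractional derivative is
    (1 - sigma) f + sigma (alpha z^(alpha - 1) e_(k-1) (z^alpha))^-1 f' ([frac_derivE]); as
    the coefficients act on the left, it is right linear in f. It is measurable, f' being a
    pointwise limit of difference quotients. The triangle inequality then comes from
    integrating |p + q|^2 <= (1 + t) |p|^2 + (1 + 1/t) |q|^2 and optimizing over t
    ([sqrt_triangle]).

    Suppose now that the norm of f is 0. Then f (1/2) = 0 and the fractional derivative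
    vanishes almost everywhere, so that |f'| <= c |f| almost everywhere on Re z >= 1/4
    ([sder_le]). By Fubini the inequality holds almost everywhere on horizontal lines
    arbitrarily close to the real axis ([null_sections]). On such a line |f|^2 is
    differentiable everywhere and its derivative is at most K |f|^2 almost everywhere. The
    derivative need not be integrable a priori, but a function that is differentiable
    everywhere with a derivative that is nonpositive almost everywhere is nonincreasing
    ([ae_derive_le0]), and this is enough for a Gronwall estimate ([ae_gronwall]). Letting the
    line tend to the real axis gives |f (x)|^2 <= exp (K) |f (1/2)|^2 = 0 for real x near 1/2
    ([real_vanishing]).

    Finally, on every plane C(J) the function f is made of holomorphic components
    ([sderiv_cdifferentiable]), which vanish on a real interval, hence on the whole slit disc,
    by an identity principle that needs no power series. The basic case ([square_unique]):
    if H is holomorphic on a square centred at 0 and vanishes on the bottom side, then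
    G s = H (s) H (i s) H (- s) H (- i s) vanishes on the four sides. Cauchy's theorem for
    s |-> G (s) conj (G (conj s)) on the upper half of the square says that the integral of
    |G|^2 over the horizontal axis is 0, so H (0)^4 = G 0 = 0. Since the planes C(J) cover E,
    the function f is 0 ([slice_regular_eq0]). *)

Set Implicit Arguments.
Unset Strict Implicit.
Unset Printing Implicit Defensive.

(** * The quaternionic modulus *)

Section QuaternionModulus.
Variable R : realType.
Local Notation H := (quat R).
Implicit Types p q : H.

Lemma quatP p q : qr p = qr q -> qi p = qi q -> qj p = qj q -> qk p = qk q -> p = q.
Proof. by case: p; case: q => a b c d a' b' c' d' /= -> -> -> ->. Qed.

Lemma quat_norm1 : `|1 : H| = 1.
Proof. by rewrite quat_normE /quat_norm /quat_sqnorm /= expr0n expr1n !addr0 sqrtr1. Qed.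

Lemma quat_normV q : `|q^-1| = `|q|^-1.
Proof.
have [->|q0] := eqVneq q 0; first by rewrite invr0 normr0 invr0.
have n0 : `|q| != 0 by rewrite normr_eq0.
by apply: (mulfI n0); rewrite -quat_normM mulrV ?quat_unitE// divff// quat_norm1.
Qed.

Lemma quat_sqr_norm q : `|q| ^+ 2 = quat_sqnorm q.
Proof. by rewrite quat_normE /quat_norm sqr_sqrtr// quat_sqnorm_ge0. Qed.

Lemma quat_qr_le q : `|qr q| <= `|q|.
Proof.
rewrite -(@ler_pXn2r _ 2) ?nnegrE// quat_sqr_norm real_normK ?num_real//.
by rewrite /quat_sqnorm -!addrA lerDl !addr_ge0// sqr_ge0.
Qed.

Lemma quat_qi_le q : `|qi q| <= `|q|.
Proof.
rewrite -(@ler_pXn2r _ 2) ?nnegrE// quat_sqr_norm real_normK ?num_real//.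
by rewrite /quat_sqnorm; have := sqr_ge0 (qr q); have := sqr_ge0 (qj q); have := sqr_ge0 (qk q); lra.
Qed.

Lemma quat_qj_le q : `|qj q| <= `|q|.
Proof.
rewrite -(@ler_pXn2r _ 2) ?nnegrE// quat_sqr_norm real_normK ?num_real//.
by rewrite /quat_sqnorm addrAC lerDr !addr_ge0// sqr_ge0.
Qed.

Lemma quat_qk_le q : `|qk q| <= `|q|.
Proof.
rewrite -(@ler_pXn2r _ 2) ?nnegrE// quat_sqr_norm real_normK ?num_real//.
by rewrite /quat_sqnorm lerDr !addr_ge0// sqr_ge0.
Qed.

Definition qdot p q : R := qr p * qr q + qi p * qi q + qj p * qj q + qk p * qk q.

Lemma qdot_le p q : `|2 * qdot p q| <= `|p| ^+ 2 + `|q| ^+ 2.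
Proof.
rewrite !quat_sqr_norm /quat_sqnorm /qdot ler_norml; case: p => a b c d; case: q => a' b' c' d' /=.
have := sqr_ge0 (a + a'); have := sqr_ge0 (b + b'); have := sqr_ge0 (c + c').
have := sqr_ge0 (d + d'); have := sqr_ge0 (a - a'); have := sqr_ge0 (b - b').
by have := sqr_ge0 (c - c'); have := sqr_ge0 (d - d'); rewrite !sqrrD ?sqrrN; lra.
Qed.

Lemma sqr_norm_add_le p q (t : R) : 0 < t ->
  `|p + q| ^+ 2 <= (1 + t) * `|p| ^+ 2 + (1 + t^-1) * `|q| ^+ 2.
Proof.
move=> t0; have ti0 : 0 < t^-1 by rewrite invr_gt0.
apply: (@le_trans _ _ ((`|p| + `|q|) ^+ 2)).
  by rewrite ler_pXn2r ?nnegrE ?addr_ge0// ler_normD.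
rewrite -subr_ge0; move: (`|p|) (`|q|) => x y.
have -> : (1 + t) * x ^+ 2 + (1 + t^-1) * y ^+ 2 - (x + y) ^+ 2 = t * (x - t^-1 * y) ^+ 2.
  by field; rewrite gt_eqF.
by rewrite mulr_ge0 ?sqr_ge0// ltW.
Qed.

End QuaternionModulus.

(** * First order expansions of real functions *)

Section FirstOrderExpansion.
Variable R : realType.
Implicit Types (f : R -> R) (x D : R).

Lemma derive_approx f x D : is_derive x 1 f D -> forall e : R, 0 < e ->
  exists2 d : R, 0 < d & forall t, `|t - x| < d -> `|f t - f x - (t - x) * D| <= e * `|t - x|.
Proof.
move=> fD e e0.
have : (fun h => h^-1 *: ((f \o shift x) (h *: 1) - f x)) @ 0^' --> D.
  by have [] := fD => fx <-; exact: fx.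
move=> /cvgrPdist_lt /(_ _ e0)[d /= d0 dP]; exists d => // t td.
have [->|tx] := eqVneq t x; first by rewrite !subrr mul0r subr0 normr0 mulr0.
have tx0 : t - x != 0 by rewrite subr_eq0.
have := dP (t - x); rewrite /= sub0r normrN => /(_ td tx0).
rewrite /shift /= /GRing.scale/= mulr1 subrK => /ltW h.
rewrite (_ : _ - _ = - (D - (t - x)^-1 * (f t - f x)) * (t - x)); last by field.
by rewrite normrM normrN ler_wpM2r.
Qed.

Lemma is_derive_approx f x D :
  (forall e : R, 0 < e -> exists2 d : R, 0 < d & forall t, `|t - x| < d ->
    `|f t - f x - (t - x) * D| <= e * `|t - x|) -> is_derive x 1 f D.
Proof.
move=> fD.
have cv : (fun t => t^-1 *: ((f \o shift x) (t *: 1) - f x)) @ 0^' --> D.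
  apply/cvgrPdist_le => e e0; have [d d0 dP] := fD e e0.
  rewrite /dnbhs /within /=; apply/nbhs_normP; exists d => //= t td t0.
  have nt : 0 < `|t| by rewrite normr_gt0.
  have tx : t + x - x = t by ring.
  have {}td : `|t| < d by move: td; rewrite /ball_/= sub0r normrN.
  have := dP (t + x); rewrite tx => /(_ td) L.
  rewrite /= /GRing.scale/= mulr1 distrC -(ler_pM2r nt) -normrM.
  suff -> : (t^-1 * (f (t + x) - f x) - D) * t = f (t + x) - f x - t * D by [].
  by field.
by split; [apply/cvg_ex; exists D|exact: cvg_lim].
Qed.

End FirstOrderExpansion.

(** * Bisection of rectangles and integrals over segments *)

Section RectangleBisection.
Variable R : realType.

(** If P failed on the rectangle of size 2 s0 by s0, it would fail on one of its four quarters,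
    and so on along a nested sequence of rectangles, in contradiction with [local] at their
    common point. The ratio 2 of the sides is preserved by the subdivision, and is the shape
    of the upper half of a square. *)
Lemma rect_bisection (P : R -> R -> R -> Prop) (x0 y0 s0 : R) : 0 < s0 ->
  (forall x y s, 0 < s -> x0 <= x -> x + 2 * s <= x0 + 2 * s0 ->
     y0 <= y -> y + s <= y0 + s0 ->
     P x y (s / 2) -> P (x + s) y (s / 2) -> P x (y + s / 2) (s / 2) ->
     P (x + s) (y + s / 2) (s / 2) -> P x y s) ->
  (forall p q, x0 <= p <= x0 + 2 * s0 -> y0 <= q <= y0 + s0 ->
     exists2 d, 0 < d & forall x y s, 0 < s < d ->
       x0 <= x -> x + 2 * s <= x0 + 2 * s0 -> y0 <= y -> y + s <= y0 + s0 ->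
       x <= p <= x + 2 * s -> y <= q <= y + s -> P x y s) ->
  P x0 y0 s0.
Proof.
move=> s0_gt0 merge local; apply: contrapT => nP0.
pose step (c : R * R) (s : R) : R * R :=
  if pselect (P c.1 c.2 (s / 2)) then
  if pselect (P (c.1 + s) c.2 (s / 2)) then
  if pselect (P c.1 (c.2 + s / 2) (s / 2)) then (c.1 + s, c.2 + s / 2)
  else (c.1, c.2 + s / 2) else (c.1 + s, c.2) else c.
pose fix c n : R * R :=
  if n is m.+1 then step (c m) (s0 / 2 ^+ m) else (x0, y0).
pose s n : R := s0 / 2 ^+ n.
have sS n : s n.+1 = s n / 2 by rewrite /s exprSr invfM mulrA.
have s_gt0 n : 0 < s n by rewrite divr_gt0// exprn_gt0.
have stepP n : [/\ (c n).1 <= (c n.+1).1, (c n.+1).1 + 2 * s n.+1 <= (c n).1 + 2 * s n,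
    (c n).2 <= (c n.+1).2 & (c n.+1).2 + s n.+1 <= (c n).2 + s n].
  have := s_gt0 n; rewrite sS /= /step -/(s n).
  by do 3?[case: pselect => ? /=]; split; lra.
have inv n : [/\ x0 <= (c n).1, (c n).1 + 2 * s n <= x0 + 2 * s0, y0 <= (c n).2,
    (c n).2 + s n <= y0 + s0 & ~ P (c n).1 (c n).2 (s n)].
  elim: n => [|n [h1 h2 h3 h4 h5]]; first by rewrite /s /= expr0 divr1; split.
  have [g1 g2 g3 g4] := stepP n.
  split; [lra|lra|lra|lra|].
  move=> Pn; apply: h5; have := Pn; rewrite sS /= /step -/(s n).
  case: pselect => p1 /=; last by [].
  case: pselect => p2 /=; last by [].
  case: pselect => p3 /=; last by [].
  by move=> p4; exact: merge.
have mono m n : (m <= n)%N -> [/\ (c m).1 <= (c n).1,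
    (c n).1 + 2 * s n <= (c m).1 + 2 * s m, (c m).2 <= (c n).2
    & (c n).2 + s n <= (c m).2 + s m].
  move=> /subnK <-; elim: (n - m)%N => [|k [g1 g2 g3 g4]]; first by split.
  by have [g5 g6 g7 g8] := stepP (k + m)%N; rewrite addSn; split; lra.
have ub1 m n : (c n).1 <= (c m).1 + 2 * s m.
  have := s_gt0 m; have := s_gt0 n.
  by have [/mono[]|/ltnW/mono[]] := leqP m n; lra.
have ub2 m n : (c n).2 <= (c m).2 + s m.
  have := s_gt0 m; have := s_gt0 n.
  by have [/mono[]|/ltnW/mono[]] := leqP m n; lra.
pose p := sup (range (fst \o c)); pose q := sup (range (snd \o c)).
have pP n : (c n).1 <= p <= (c n).1 + 2 * s n.
  apply/andP; split.
    apply: ub_le_sup; last by exists n.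
    by exists (x0 + 2 * s0) => _ [m _ <-]; have [] := inv m; have := s_gt0 m => /=; lra.
  by apply: ge_sup; [exists x0, 0%N | move=> _ [m _ <-]; exact: ub1].
have qP n : (c n).2 <= q <= (c n).2 + s n.
  apply/andP; split.
    apply: ub_le_sup; last by exists n.
    by exists (y0 + s0) => _ [m _ <-]; have [] := inv m; have := s_gt0 m => /=; lra.
  by apply: ge_sup; [exists y0, 0%N | move=> _ [m _ <-]; exact: ub2].
have [d d_gt0 dP] := local p q ltac:(have := pP 0%N; rewrite /s /= expr0 divr1//)
  ltac:(have := qP 0%N; rewrite /s /= expr0 divr1//).
have [n sn] : exists n, s n < d.
  exists (Num.bound (s0 / d)); set n := Num.bound _.
  have sn : s0 / d < n%:R by apply: archi_boundP; rewrite divr_ge0 ?ltW.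
  rewrite ltr_pdivrMr ?exprn_gt0// mulrC -ltr_pdivrMr//.
  by rewrite (lt_trans sn)// -natrX ltr_nat ltn_expl.
have [h1 h2 h3 h4] := inv n; apply.
by apply: dP => //; rewrite s_gt0.
Qed.

End RectangleBisection.

Section SegmentIntegral.
Variable R : realType.
Local Notation mu := (@lebesgue_measure R).
Implicit Types (f g : R -> R) (a b m : R).

Definition segint f a b : R := \int[mu]_(x in `[a, b]) f x.

Definition continuous_on f a b := forall x, a <= x <= b -> {for x, continuous f}.

Lemma continuous_onS f a b a' b' : a <= a' -> b' <= b ->
  continuous_on f a b -> continuous_on f a' b'.
Proof. by move=> aa bb fc x /andP[xa xb]; apply: fc; lra. Qed.

Lemma continuous_on_integrable f a b : continuous_on f a b ->
  mu.-integrable `[a, b] (EFin \o f).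
Proof.
move=> fc; apply: continuous_compact_integrable; first exact: segment_compact.
apply: continuous_subspace_itv => x; rewrite in_itv/= => xab; exact: fc.
Qed.

Lemma segint_split f a m b : a <= m -> m <= b -> continuous_on f a b ->
  segint f a b = segint f a m + segint f m b.
Proof.
move=> am mb fc; have fi := continuous_on_integrable fc.
rewrite /segint -[X in X = _](subrK (segint f a m)) addrC; congr (_ + _).
rewrite /segint (@Rintegral_itvB _ f _ _ m fi) ?bnd_simp//.
rewrite Rintegral_itv_obnd_cbnd//.
apply: integrableS fi => //.
by apply: subset_itvr; rewrite bnd_simp.
Qed.

Lemma segint_cst (k a b : R) : a <= b -> segint (cst k) a b = k * (b - a).
Proof.
move=> ab; rewrite /segint Rintegral_cst//= lebesgue_measure_itv/= lte_fin.
by case: ltgtP ab => //= -> _; rewrite subrr.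
Qed.

Lemma le_segint f g a b : continuous_on f a b -> continuous_on g a b ->
  (forall x, a <= x <= b -> f x <= g x) -> segint f a b <= segint g a b.
Proof.
move=> fc gc fg; apply: le_Rintegral => [//|||x]; try exact: continuous_on_integrable.
by rewrite /= in_itv/=; exact: fg.
Qed.

Lemma segintB f g a b : continuous_on f a b -> continuous_on g a b ->
  segint (fun x => f x - g x) a b = segint f a b - segint g a b.
Proof. by move=> fc gc; rewrite /segint RintegralB//; exact: continuous_on_integrable. Qed.

(** Estimate for the two opposite sides of a small rectangle, along which a differentiable
    function differs by a nearly constant amount. *)
Lemma segint_diff_approx f g a b (k e : R) : a <= b ->
  continuous_on f a b -> continuous_on g a b ->
  (forall x, a <= x <= b -> `|f x - g x - k| <= e) ->
  `|segint f a b - segint g a b - k * (b - a)| <= e * (b - a).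
Proof.
move=> ab fc gc fg.
have fgc : continuous_on (fun x => f x - g x) a b.
  by move=> x xab; apply: cvgB; [exact: fc|exact: gc].
have cc (c : R) : continuous_on (cst c) a b by move=> x _; exact: cst_continuous.
rewrite -segintB//.
have h1 : segint (fun x => f x - g x) a b <= (k + e) * (b - a).
  rewrite -segint_cst//; apply: le_segint => // x xab; rewrite /cst.
  by have := fg x xab; rewrite ler_norml => /andP[]; lra.
have h2 : (k - e) * (b - a) <= segint (fun x => f x - g x) a b.
  rewrite -segint_cst//; apply: le_segint => // x xab; rewrite /cst.
  by have := fg x xab; rewrite ler_norml => /andP[]; lra.
by rewrite ler_norml; apply/andP; split; lra.
Qed.

Lemma segint_eq0 f a b m : a < m < b -> continuous_on f a b ->
  (forall x, a <= x <= b -> 0 <= f x) -> segint f a b = 0 -> f m = 0.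
Proof.
move=> /andP[am mb] fc f0 If; apply/eqP; rewrite eq_le f0 ?andbT; last by rewrite !ltW.
rewrite leNgt; apply/negP => fm.
have /cvgrPdist_lt /(_ (f m / 2)) : {for m, continuous f} by apply: fc; rewrite !ltW.
rewrite divr_gt0// => /(_ erefl)[d /= d0 dP].
pose e := Num.min (d / 2) (Num.min (m - a) (b - m)).
have e0 : 0 < e by rewrite !lt_min divr_gt0//=; apply/andP; split; lra.
have ed : e <= d / 2 by rewrite ge_min lexx.
have ea : e <= m - a by rewrite !ge_min lexx /= orbT.
have eb : e <= b - m by rewrite !ge_min lexx /= !orbT.
have cc c a' b' : continuous_on (cst c) a' b' by move=> x _; exact: cst_continuous.
have nn u v : a <= u -> u <= v -> v <= b -> 0 <= segint f u v.
  move=> au uv vb; rewrite -[X in X <= _](mul0r (v - u)) -segint_cst//.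
  by apply: le_segint => //; [exact: continuous_onS fc | move=> x /andP[? ?]; apply: f0; lra].
have pos : f m / 2 * (m - (m - e)) <= segint f (m - e) m.
  rewrite -segint_cst; last lra.
  apply: le_segint => //; first by apply: continuous_onS fc; lra.
  move=> x /andP[x1 x2]; rewrite /cst.
  have /= : `|f m - f x| < f m / 2 by apply: dP; rewrite /= ger0_norm; lra.
  by rewrite ltr_norml => /andP[]; lra.
have h1 := nn a (m - e) (lexx _) ltac:(lra) ltac:(lra).
have h2 := nn m b ltac:(lra) ltac:(lra) (lexx _).
move: If; rewrite (@segint_split _ a m b) ?ltW// (@segint_split _ a (m - e) m);
  [|lra|lra|by apply: continuous_onS fc; lra].
have : 0 < f m / 2 * (m - (m - e)) by rewrite mulr_gt0 ?divr_gt0//; lra.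
by lra.
Qed.

End SegmentIntegral.

(** * Complex differentiability *)

Section ComplexDerivative.
Variable R : realType.
Local Open Scope complex_scope.
Local Notation C := (complex R).
Local Notation Re := (@complex.Re R).
Local Notation Im := (@complex.Im R).
Implicit Types (F G : C -> C) (z w c d D : C).

Definition is_cderiv F z D := forall e : R, 0 < e -> exists2 d : R, 0 < d &
  forall w, normc (w - z) < d ->
    normc (F w - F z - D * (w - z)) <= e * normc (w - z).

Definition cdifferentiable F z := exists D, is_cderiv F z D.

Lemma normc_ge0 z : 0 <= normc z.
Proof. by case: z => x y; exact: sqrtr_ge0. Qed.

Lemma normc_gt0 z : (0 < normc z) = (z != 0).
Proof.
rewrite lt_neqAle normc_ge0 andbT eq_sym; congr (~~ _); apply/eqP/eqP => [/eq0_normc//|->].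
exact: normc0.
Qed.

Lemma sqr_normc z : normc z ^+ 2 = Re z ^+ 2 + Im z ^+ 2.
Proof. by case: z => x y /=; rewrite sqr_sqrtr// addr_ge0 ?sqr_ge0. Qed.

Lemma ReB z w : Re (z - w) = Re z - Re w.
Proof. by case: z; case: w. Qed.

Lemma ImB z w : Im (z - w) = Im z - Im w.
Proof. by case: z; case: w. Qed.

Lemma normr_Re z : `|Re z| <= normc z.
Proof.
rewrite -[leRHS]ger0_norm ?normc_ge0// -(@ler_pXn2r _ 2) ?nnegrE//.
by rewrite !real_normK ?num_real// sqr_normc lerDl sqr_ge0.
Qed.

Lemma normr_Im z : `|Im z| <= normc z.
Proof.
rewrite -[leRHS]ger0_norm ?normc_ge0// -(@ler_pXn2r _ 2) ?nnegrE//.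
by rewrite !real_normK ?num_real// sqr_normc lerDr sqr_ge0.
Qed.

Lemma normc_le z : normc z <= `|Re z| + `|Im z|.
Proof.
rewrite -[leLHS]ger0_norm ?normc_ge0// -[leRHS]ger0_norm ?addr_ge0//.
rewrite -(@ler_pXn2r _ 2) ?nnegrE// !real_normK ?num_real// sqr_normc.
rewrite sqrrD !real_normK ?num_real// lerD2r lerDl mulrn_wge0// mulr_ge0//.
Qed.

Lemma normcJ z : normc z^* = normc z.
Proof. by case: z => x y /=; rewrite sqrrN. Qed.

Lemma normc_real (x : R) : normc x%:C = `|x|.
Proof. by rewrite /= expr0n addr0 sqrtr_sqr. Qed.

Lemma normc_sub z w : normc (z - w) = normc (w - z).
Proof. by rewrite -normcN opprB. Qed.

Lemma cderiv_lipschitz F z D : is_cderiv F z D -> exists2 d : R, 0 < d &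
  forall w, normc (w - z) < d -> normc (F w - F z) <= (normc D + 1) * normc (w - z).
Proof.
move=> /(_ 1 ltr01)[d d0 dP]; exists d => // w /dP h.
rewrite -[F w - F z](subrK (D * (w - z))) (le_trans (le_normcD _ _))// normcM.
by rewrite mulrDl mul1r addrC lerD2l -[leRHS]mul1r.
Qed.

Lemma cderivM F G z D E : is_cderiv F z D -> is_cderiv G z E ->
  is_cderiv (fun w => F w * G w) z (D * G z + F z * E).
Proof.
move=> FD GE e e0.
have [d1 d10 d1P] := cderiv_lipschitz FD; have [d2 d20 d2P] := cderiv_lipschitz GE.
set M := normc (F z) + normc (G z) + 1.
have M1 : 0 < M by rewrite ltr_wpDl// addr_ge0// normc_ge0.
set K := (normc D + 1) * (normc E + 1).
have K0 : 0 < K by rewrite mulr_gt0// ltr_wpDl// normc_ge0.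
have e20 : 0 < e / 2 by rewrite divr_gt0.
have [d3 d30 d3P] := FD (e / 2 / M) ltac:(by rewrite divr_gt0).
have [d4 d40 d4P] := GE (e / 2 / M) ltac:(by rewrite divr_gt0).
exists (Num.min (Num.min d1 d2) (Num.min (Num.min d3 d4) (e / 2 / K))) => [|w].
  by rewrite !lt_min d10 d20 d30 d40 divr_gt0.
rewrite !lt_min => /andP[/andP[/d1P h1 /d2P h2] /andP[/andP[/d3P h3 /d4P h4] h5]].
set h := w - z in h1 h2 h3 h4 h5 *.
have -> : F w * G w - F z * G z - (D * G z + F z * E) * h =
  (F w - F z - D * h) * G z + F z * (G w - G z - E * h) + (F w - F z) * (G w - G z).
  by ring.
have n0 := normc_ge0 h.
apply: (le_trans (le_normcD _ _)).
apply: (le_trans (lerD (le_normcD _ _) (lexx _))); rewrite !normcM.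
apply: (@le_trans _ _ (e / 2 / M * normc h * normc (G z) + normc (F z) * (e / 2 / M * normc h)
   + K * normc h * normc h)).
  apply: lerD; first by apply: lerD; [rewrite ler_wpM2r ?normc_ge0|rewrite ler_wpM2l ?normc_ge0].
  apply: (le_trans (ler_pM (normc_ge0 _) (normc_ge0 _) h1 h2)).
  by rewrite /K le_eqVlt; apply/orP; left; apply/eqP; ring.
have -> : e / 2 / M * normc h * normc (G z) + normc (F z) * (e / 2 / M * normc h) + K * normc h * normc h
  = (e / 2 / M * (normc (F z) + normc (G z)) + K * normc h) * normc h by ring.
rewrite ler_wpM2r// [leRHS]splitr lerD//.
  rewrite -mulrA ler_piMr ?(ltW e20)// ler_pdivrMl// mulr1 /M lerDl//.
by rewrite -ler_pdivlMl// mulrC ltW.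
Qed.

Lemma cderiv_affine F c d z D : is_cderiv F (c + d * z) D ->
  is_cderiv (fun w => F (c + d * w)) z (D * d).
Proof.
move=> FD e e0.
have d1 : 0 < normc d + 1 by rewrite ltr_wpDl// normc_ge0.
have [r r0 rP] := FD (e / (normc d + 1)) ltac:(by rewrite divr_gt0).
exists (r / (normc d + 1)) => [|w]; first by rewrite divr_gt0.
rewrite ltr_pdivlMr// => wz.
have E : c + d * w - (c + d * z) = d * (w - z) by ring.
have := rP (c + d * w); rewrite E normcM mulrA; move=> h.
apply: (le_trans (h _)).
  by rewrite (le_lt_trans _ wz)// mulrC ler_wpM2l ?normc_ge0// lerDl.
by rewrite mulrA ler_wpM2r ?normc_ge0// -mulrA ler_piMr ?(ltW e0)// ler_pdivrMl// mulr1 lerDl ler01.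
Qed.

Lemma cderivJ F z D : is_cderiv F z^* D -> is_cderiv (fun w => (F w^*)^*) z D^*.
Proof.
move=> FD e /FD[r r0 rP]; exists r => // w wz.
have := rP w^*; rewrite -rmorphB normcJ => /(_ wz).
by rewrite -[normc (_ - _)]normcJ !rmorphB/= rmorphM/= rmorphB/= !conjcK.
Qed.

Lemma cdifferentiableM F G z : cdifferentiable F z -> cdifferentiable G z ->
  cdifferentiable (fun w => F w * G w) z.
Proof. by move=> [D FD] [E GE]; exists (D * G z + F z * E); exact: cderivM. Qed.

Lemma cdifferentiable_affine F c d z : cdifferentiable F (c + d * z) ->
  cdifferentiable (fun w => F (c + d * w)) z.
Proof. by move=> [D FD]; exists (D * d); exact: cderiv_affine. Qed.

Lemma cdifferentiableJ F z : cdifferentiable F z^* ->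
  cdifferentiable (fun w => (F w^*)^*) z.
Proof. by move=> [D FD]; exists D^*; exact: cderivJ. Qed.

Lemma cdifferentiable_cvg F z : cdifferentiable F z -> forall e : R, 0 < e ->
  exists2 d : R, 0 < d & forall w, normc (w - z) < d -> normc (F w - F z) < e.
Proof.
move=> [D /cderiv_lipschitz[d d0 dP]] e e0.
have D1 : 0 < normc D + 1 by rewrite ltr_wpDl// normc_ge0.
exists (Num.min d (e / (normc D + 1))) => [|w]; first by rewrite lt_min d0 divr_gt0.
rewrite lt_min ltr_pdivlMr// => /andP[/dP h1 h2].
by rewrite (le_lt_trans h1)// mulrC.
Qed.

Lemma cdifferentiable_continuousl F (x y : R) : cdifferentiable F (x +i* y) ->
  {for x, continuous (fun t => Re (F (t +i* y)))}.
Proof.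
move=> /cdifferentiable_cvg FD; apply/cvgrPdist_lt => e /FD[d d0 dP].
exists d => //= t tx; rewrite -ReB (le_lt_trans (normr_Re _))// normc_sub dP//.
rewrite (le_lt_trans (normc_le _))//= subrr normr0 addr0 distrC//.
Qed.

Lemma cdifferentiable_continuousr F (x y : R) : cdifferentiable F (x +i* y) ->
  {for y, continuous (fun t => Im (F (x +i* t)))}.
Proof.
move=> /cdifferentiable_cvg FD; apply/cvgrPdist_lt => e /FD[d d0 dP].
exists d => //= t ty; rewrite -ImB (le_lt_trans (normr_Im _))// normc_sub dP//.
rewrite (le_lt_trans (normc_le _))//= subrr normr0 add0r distrC//.
Qed.

End ComplexDerivative.

(** * Cauchy's theorem on rectangles *)

Section Goursat.
Variable R : realType.
Local Open Scope complex_scope.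
Local Notation C := (complex R).
Local Notation Re := (@complex.Re R).
Local Notation Im := (@complex.Im R).
Implicit Types (h : C -> C) (x y s : R).

(** The real part of the integral of h dz along the boundary of a rectangle; the imaginary
    part would be that of - i h. *)
Definition rect_period h (x1 x2 y1 y2 : R) : R :=
  segint (fun t => Re (h (t +i* y1))) x1 x2
  - segint (fun t => Re (h (t +i* y2))) x1 x2
  - (segint (fun t => Im (h (x2 +i* t))) y1 y2
     - segint (fun t => Im (h (x1 +i* t))) y1 y2).

Definition cdiff_on_rect h (x1 x2 y1 y2 : R) := forall x y,
  x1 <= x <= x2 -> y1 <= y <= y2 -> cdifferentiable h (x +i* y).

Lemma cdiff_on_rectS h (x1 x2 y1 y2 x1' x2' y1' y2' : R) :
  x1 <= x1' -> x2' <= x2 -> y1 <= y1' -> y2' <= y2 ->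
  cdiff_on_rect h x1 x2 y1 y2 -> cdiff_on_rect h x1' x2' y1' y2'.
Proof. by move=> ? ? ? ? hd x y /andP[? ?] /andP[? ?]; apply: hd; lra. Qed.

Lemma cdiff_on_rect_contl h (x1 x2 y1 y2 y : R) : cdiff_on_rect h x1 x2 y1 y2 ->
  y1 <= y <= y2 -> continuous_on (fun t => Re (h (t +i* y))) x1 x2.
Proof. by move=> hd yy x xx; apply: cdifferentiable_continuousl; exact: hd. Qed.

Lemma cdiff_on_rect_contr h (x1 x2 y1 y2 x : R) : cdiff_on_rect h x1 x2 y1 y2 ->
  x1 <= x <= x2 -> continuous_on (fun t => Im (h (x +i* t))) y1 y2.
Proof. by move=> hd xx y yy; apply: cdifferentiable_continuousr; exact: hd. Qed.

Lemma rect_period_split4 h (x1 x2 x3 y1 y2 y3 : R) :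
  x1 <= x2 -> x2 <= x3 -> y1 <= y2 -> y2 <= y3 -> cdiff_on_rect h x1 x3 y1 y3 ->
  rect_period h x1 x3 y1 y3 =
    rect_period h x1 x2 y1 y2 + rect_period h x2 x3 y1 y2 +
    rect_period h x1 x2 y2 y3 + rect_period h x2 x3 y2 y3.
Proof.
move=> x12 x23 y12 y23 hd; rewrite /rect_period.
have cl y : y1 <= y <= y3 -> continuous_on (fun t => Re (h (t +i* y))) x1 x3.
  by move=> yy; apply: cdiff_on_rect_contl hd _.
have cr x : x1 <= x <= x3 -> continuous_on (fun t => Im (h (x +i* t))) y1 y3.
  by move=> yy; apply: cdiff_on_rect_contr hd _.
rewrite (segint_split x12 x23 (cl y1 ltac:(lra))) (segint_split x12 x23 (cl y3 ltac:(lra))).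
rewrite (segint_split y12 y23 (cr x1 ltac:(lra))) (segint_split y12 y23 (cr x3 ltac:(lra))).
by ring.
Qed.

(** The affine part of h contributes nothing, and the remainder is o(s) on a boundary whose
    length is a multiple of s. *)
Lemma rect_period_local h (p q : R) : cdifferentiable h (p +i* q) ->
  forall e : R, 0 < e -> exists2 d : R, 0 < d & forall x y s, 0 < s < d ->
    cdiff_on_rect h x (x + 2 * s) y (y + s) ->
    x <= p <= x + 2 * s -> y <= q <= y + s ->
    `|rect_period h x (x + 2 * s) y (y + s)| <= e * s ^+ 2.
Proof.
move=> [D hD] e e0.
(* On the rectangle |w - (p + i q)| <= 3 s, so two values of the remainder differ by at most
   2 (e / 18) (3 s) = e s / 3; the two pairs of sides, of lengths 2 s and s, add up to e s^2. *)
have e'0 : 0 < e / 18 by rewrite divr_gt0.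
have [d d0 dP] := hD _ e'0.
exists (d / 3) => [|x y s /andP[s0 sd] hd xp yq]; first by rewrite divr_gt0.
have near x' y' : x <= x' <= x + 2 * s -> y <= y' <= y + s ->
    normc (h (x' +i* y') - h (p +i* q) - D * ((x' +i* y') - (p +i* q))) <= e / 18 * (3 * s).
  move=> xx yy.
  have n3 : normc (x' +i* y' - (p +i* q)) <= 3 * s.
    apply: (le_trans (normc_le _)) => /=.
    have : `|x' - p| <= 2 * s by rewrite ler_norml; apply/andP; split; lra.
    have : `|y' - q| <= s by rewrite ler_norml; apply/andP; split; lra.
    lra.
  apply: (le_trans (dP _ _)); first by lra.
  by rewrite ler_wpM2l// ltW.
have diff x' y' x'' y'' : x <= x' <= x + 2 * s -> y <= y' <= y + s ->
    x <= x'' <= x + 2 * s -> y <= y'' <= y + s ->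
    normc (h (x' +i* y') - h (x'' +i* y'') - D * ((x' - x'') +i* (y' - y''))) <= e / 3 * s.
  move=> h1 h2 h3 h4; have n1 := near _ _ h1 h2; have n2 := near _ _ h3 h4.
  set A := (X in normc X) in n1; set B := (X in normc X) in n2.
  rewrite (_ : _ - _ = A - B).
    by rewrite (le_trans (le_normcD _ _))// normcN; lra.
  rewrite (_ : (x' - x'') +i* (y' - y'') = (x' +i* y') - (x'' +i* y''))//.
  by rewrite /A /B; ring.
have xx : x <= x + 2 * s by lra.
have yy : y <= y + s by lra.
have xr : x <= x + 2 * s <= x + 2 * s by lra.
have xl : x <= x <= x + 2 * s by lra.
have yr : y <= y + s <= y + s by lra.
have yl : y <= y <= y + s by lra.
have H1 : `|segint (fun t => Re (h (t +i* y))) x (x + 2 * s)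
    - segint (fun t => Re (h (t +i* (y + s)))) x (x + 2 * s)
    - Im D * s * (x + 2 * s - x)| <= e / 3 * s * (x + 2 * s - x).
  apply: segint_diff_approx => [//|||t tt].
  - exact: cdiff_on_rect_contl hd _.
  - exact: cdiff_on_rect_contl hd _.
  have := diff t y t (y + s) tt yl tt yr.
  apply: le_trans; apply: le_trans (normr_Re _); rewrite !ReB.
  rewrite (_ : Re (D * _) = Im D * s)//.
  by case: (D) => a b /=; ring.
have H2 : `|segint (fun t => Im (h ((x + 2 * s) +i* t))) y (y + s)
    - segint (fun t => Im (h (x +i* t))) y (y + s)
    - Im D * (2 * s) * (y + s - y)| <= e / 3 * s * (y + s - y).
  apply: segint_diff_approx => [//|||t tt].
  - exact: cdiff_on_rect_contr hd _.
  - exact: cdiff_on_rect_contr hd _.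
  have := diff (x + 2 * s) t x t xr tt xl tt.
  apply: le_trans; apply: le_trans (normr_Im _); rewrite !ImB.
  rewrite (_ : Im (D * _) = Im D * (2 * s))//.
  by case: (D) => a b /=; ring.
rewrite /rect_period; move: H1 H2.
set A := segint _ _ _ - segint _ _ _; set B := segint _ _ _ - segint _ _ _.
rewrite !ler_norml => /andP[A1 A2] /andP[B1 B2].
by apply/andP; split; nra.
Qed.

(** Goursat's argument: the bound e s^2 holds on all small rectangles by differentiability, and
    it is inherited by a rectangle from its four quarters because s^2 = 4 (s / 2)^2. *)
Lemma goursat h x y s : 0 < s -> cdiff_on_rect h x (x + 2 * s) y (y + s) ->
  rect_period h x (x + 2 * s) y (y + s) = 0.
Proof.
move=> s0 hd; apply/eqP; rewrite -normr_le0; apply/ler_addgt0Pl => e e0; rewrite addr0.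
have e'0 : 0 < e / s ^+ 2 by rewrite divr_gt0// exprn_gt0.
rewrite -[leRHS](@divfK _ (s ^+ 2)) ?expf_eq0 ?gt_eqF//.
apply: (@rect_bisection R (fun x' y' s' =>
  `|rect_period h x' (x' + 2 * s') y' (y' + s')| <= e / s ^+ 2 * s' ^+ 2) _ _ _ s0).
- move=> x' y' s' s'0 h1 h2 h3 h4.
  have E : 2 * (s' / 2) = s' by rewrite mulrC divfK.
  rewrite E => p1 p2 p3 p4.
  rewrite (@rect_period_split4 h x' (x' + s') _ y' (y' + s' / 2)); [|lra..|]; last first.
    by apply: cdiff_on_rectS hd => //; lra.
  have F1 : x' + s' + s' = x' + 2 * s' by ring.
  have F2 : y' + s' / 2 + s' / 2 = y' + s' by field.
  rewrite F1 in p2; rewrite F2 in p3; rewrite F1 F2 in p4.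
  have -> : e / s ^+ 2 * s' ^+ 2 = 4 * (e / s ^+ 2 * (s' / 2) ^+ 2).
    by field; rewrite gt_eqF.
  move: p1 p2 p3 p4; move: (e / _ * _) => E0.
  do 4!move: (rect_period h _ _ _ _) => ?.
  rewrite !ler_norml => /andP[? ?] /andP[? ?] /andP[? ?] /andP[? ?].
  by apply/andP; split; lra.
- move=> p q pp qq.
  have [d d0 dP] := rect_period_local (hd _ _ pp qq) e'0.
  exists d => // x' y' s' s'd h1 h2 h3 h4 px qy.
  by apply: dP => //; apply: cdiff_on_rectS hd; lra.
Qed.
End Goursat.

(** * Holomorphic functions vanishing on a line segment *)

Section Uniqueness.
Variable R : realType.
Local Open Scope complex_scope.
Local Notation C := (complex R).
Local Notation Re := (@complex.Re R).
Local Notation Im := (@complex.Im R).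
Implicit Types (F G H : C -> C) (z w c d s : C).

Lemma segint0 (f : R -> R) (a b : R) : (forall x, a <= x <= b -> f x = 0) -> segint f a b = 0.
Proof.
move=> f0; rewrite /segint (@eq_Rintegral _ _ R lebesgue_measure _ (cst 0)).
  by rewrite Rintegral_cst// mul0r.
by move=> x; rewrite inE/= in_itv/=; exact: f0.
Qed.

(** The four rotations of H vanish in turn on each of the four sides, so their product G
    vanishes on the whole boundary; on the horizontal axis the function h below is |G|^2. *)
Lemma square_unique H :
  (forall z, `|Re z| <= 1 -> `|Im z| <= 1 -> cdifferentiable H z) ->
  (forall t : R, `|t| <= 1 -> H (t -i* 1) = 0) -> H 0 = 0.
Proof.
move=> Hd H0.
pose G s := H (0 + 1 * s) * H (0 + 'i * s) * H (0 + (-1) * s) * H (0 + (- 'i) * s).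
have Gd s : `|Re s| <= 1 -> `|Im s| <= 1 -> cdifferentiable G s.
  by case: s => a b /= ha hb; do 3?[apply: cdifferentiableM];
    apply: cdifferentiable_affine; apply: Hd => /=;
    rewrite ?(add0r, mul0r, mul1r, mulN1r, oppr0, subr0, addr0, sub0r, normrN, mulNr, opprK).
have G0 s : `|Re s| = 1 \/ Im s = 1 -> `|Im s| <= 1 -> `|Re s| <= 1 -> G s = 0.
  case: s => a b /= + hb ha.
  have E (d : C) t : d * (a +i* b) = t -i* 1 -> `|t| <= 1 -> H (0 + d * (a +i* b)) = 0.
    by move=> -> ?; rewrite add0r H0.
  rewrite /G => -[/eqP|b1].
    rewrite eqr_norml ler01 andbT => /orP[]/eqP a1.
      rewrite [X in _ * X](E _ b) ?mulr0// a1.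
      by apply/eqP; rewrite eq_complex /=; apply/andP; split; apply/eqP; ring.
    rewrite [X in _ * X * _ * _](E _ (- b)) ?normrN ?mulr0 ?mul0r// a1.
    by apply/eqP; rewrite eq_complex /=; apply/andP; split; apply/eqP; ring.
  rewrite [X in _ * X * _](E _ (- a)) ?normrN ?mulr0 ?mul0r// b1.
  by apply/eqP; rewrite eq_complex /=; apply/andP; split; apply/eqP; ring.
pose h s := G s * (G s^*)^*.
have hd : cdiff_on_rect h (-1) (-1 + 2 * 1) 0 (0 + 1).
  move=> x y xx yy; have hx : `|x| <= 1 by rewrite ler_norml; lra.
  have hy : `|y| <= 1 by rewrite ler_norml; lra.
  apply: cdifferentiableM; first exact: Gd.
  by apply: cdifferentiableJ; apply: Gd; rewrite //= normrN.
have N1 : `|-1| = 1 :> R by rewrite normrN1.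
have := goursat ltr01 hd; rewrite /rect_period.
have -> : -1 + 2 * 1 = 1 :> R by ring.
rewrite add0r.
have -> : segint (fun t => Re (h (t +i* 1))) (-1) 1 = 0.
  apply: segint0 => t tt; rewrite /h G0 ?mul0r//=; [by right|by rewrite normr1|].
  by rewrite ler_norml.
have -> : segint (fun t => Im (h (1 +i* t))) 0 1 = 0.
  apply: segint0 => t tt; rewrite /h G0 ?mul0r//=; rewrite ?normr1//; first by left.
  by rewrite ler_norml; lra.
have -> : segint (fun t => Im (h ((-1) +i* t))) 0 1 = 0.
  apply: segint0 => t tt; rewrite /h G0 ?mul0r//=; rewrite ?N1//; first by left.
  by rewrite ler_norml; lra.
rewrite !subr0 => /(@segint_eq0 _ _ _ _ 0) E.
have {E} : Re (h 0) = 0.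
  apply: E => [|x xx|x xx].
  - by rewrite oppr_lt0 ltr01.
  - by apply: cdifferentiable_continuousl; apply: hd; lra.
  - rewrite /h (_ : (x +i* 0)^* = x +i* 0); last by rewrite /= oppr0.
    by case: (G _) => a b /=; rewrite mulrN opprK -!expr2 addr_ge0// sqr_ge0.
rewrite /h (_ : 0^* = 0); last by rewrite /= oppr0.
have -> : G 0 = H 0 ^+ 4 by rewrite /G !mulr0 !addr0; ring.
case: (H 0 ^+ 4) (@expf_eq0 C (H 0) 4) => a b E /= /eqP.
rewrite mulrN opprK -!expr2 paddr_eq0 ?sqr_ge0// !sqrf_eq0 => ab.
by case/andP: ab E => /eqP-> /eqP->; rewrite eqxx /= => /esym/eqP.
Qed.

Lemma affine_square_unique F c d :
  (forall z, `|Re z| <= 1 -> `|Im z| <= 1 -> cdifferentiable F (c + d * z)) ->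
  (forall t : R, `|t| <= 1 -> F (c + d * (t -i* 1)) = 0) -> F c = 0.
Proof.
move=> Fd F0; rewrite -[c]addr0 -[X in c + X](mulr0 d).
apply: (@square_unique (fun z => F (c + d * z))) => // z ? ?.
by apply: cdifferentiable_affine; exact: Fd.
Qed.

(** The square centred at z whose bottom side passes through the midpoint of c and z stays in
    the disc of radius r, as 2 |z - c| < r. Its bottom side is at distance at most
    sqrt 2 / 2 |z - c| from c, so it lies where F is already known to vanish. *)
Lemma disc_unique_step F c (r e : R) : (forall z, normc (z - c) < r -> cdifferentiable F z) ->
  (forall z, normc (z - c) < e -> F z = 0) ->
  forall z, normc (z - c) < r / 2 -> normc (z - c) < 5 / 4 * e -> F z = 0.
Proof.
move=> Fd F0 z; set n := normc (z - c) => zr ze.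
have n0 : 0 <= n by exact: normc_ge0.
(* The map w |-> z + d w sends the square of side 2 centred at 0 onto the chosen square. *)
pose d := - 'i * ((z - c) / 2).
have Nd : normc d = n / 2.
  rewrite /d normcM normcN /= expr0n expr1n add0r sqrtr1 mul1r normcM normcV -/n.
  rewrite (_ : (2 : C) = (2 : R)%:C); last by rewrite rmorph_nat.
  by rewrite normc_real ger0_norm.
apply: (@affine_square_unique F z d) => [w w1 w2|t t1].
  apply: Fd; rewrite addrAC (le_lt_trans (le_normcD _ _))// normcM Nd -/n.
  have : normc w <= 2 by apply: (le_trans (normc_le _)); lra.
  have := normc_ge0 w; nra.
have -> : z + d * (t -i* 1) = c + d * (t +i* 1).
  rewrite (_ : t -i* 1 = (t +i* 1) - 2 * 'i); last first.
    by apply/eqP; rewrite eq_complex /=; apply/andP; split; apply/eqP; ring.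
  have i2 : 'i * 'i = -1 :> C by rewrite -expr2 sqr_i.
  rewrite mulrBr (_ : d * (2 * 'i) = z - c); first by ring.
  transitivity (- ('i * 'i) * (z - c)); first by rewrite /d; field.
  by rewrite i2; ring.
apply: F0; rewrite addrC addKr normcM Nd.
have : normc (t +i* 1) ^+ 2 <= 2.
  rewrite sqr_normc /= expr1n; have : t ^+ 2 <= 1
    by rewrite -real_normK ?num_real// expr_le1.
  by lra.
have := normc_ge0 (t +i* 1); move: (normc (t +i* 1)) => m m0 m2.
have : m <= 3 / 2 by nra.
nra.
Qed.

(** Each step multiplies the radius of the disc of zeros by 5 / 4, until r / 2 is reached. *)
Lemma disc_unique F c (r e : R) : 0 < e -> (forall z, normc (z - c) < r -> cdifferentiable F z) ->
  (forall z, normc (z - c) < e -> F z = 0) ->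
  forall z, normc (z - c) < r / 2 -> F z = 0.
Proof.
move=> e0 Fd F0 z zr.
have grow n : forall w, normc (w - c) < r / 2 -> normc (w - c) < (5 / 4) ^+ n * e -> F w = 0.
  elim: n => [|n IHn] w wr; first by rewrite expr0 mul1r; exact: F0.
  rewrite exprS -mulrA => wn.
  have [rn|nr] := leP (r / 2) ((5 / 4) ^+ n * e).
    by apply: IHn => //; lra.
  apply: (@disc_unique_step F c r ((5 / 4) ^+ n * e)) => // v vn.
  by apply: IHn => //; lra.
have [n rn] : exists n, r / 2 <= (5 / 4) ^+ n * e.
  have := @archi_boundP R (4 * (`|r| / e)).
  set n := Num.bound _ => /(_ ltac:(by rewrite mulr_ge0// divr_ge0// (ltW e0))) rn.
  exists n; have : 1 + n%:R * (1 / 4) <= (5 / 4 : R) ^+ n.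
    elim: (n) => [|m IHm]; first by rewrite mul0r addr0 expr0.
    rewrite exprS -natr1; have : 0 <= m%:R :> R by []. nra.
  rewrite -ler_pdivrMr// => h; apply: le_trans h.
  have : r / 2 / e <= `|r| / e by rewrite ler_pM2r ?invr_gt0//; have := ler_norm r; have := normr_ge0 r; lra.
  lra.
by apply: (grow n) => //; lra.
Qed.

End Uniqueness.

Section IdentityTheorem.
Variable R : realType.
Local Open Scope complex_scope.
Local Notation C := (complex R).
Local Notation Re := (@complex.Re R).
Local Notation Im := (@complex.Im R).
Implicit Types (F : C -> C) (z w c : C).

(** The square centred at w with half side |Im w| has a side on the real axis. *)
Lemma real_interval_unique F (c r : R) :
  (forall w, normc (w - c%:C) < r -> cdifferentiable F w) ->
  (forall x : R, `|x - c| < r -> F x%:C = 0) ->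
  forall w, normc (w - c%:C) < r / 4 -> F w = 0.
Proof.
move=> Fd F0 [x y] wr.
have hx : `|x - c| < r / 4 by rewrite (le_lt_trans (normr_Re _) wr).
have hy : `|y| < r / 4.
  by have := normr_Im (x +i* y - c%:C); rewrite ImB subr0 => /le_lt_trans; exact.
have y0 := normr_ge0 y; have x0 := normr_ge0 (x - c).
apply: (@affine_square_unique _ F (x +i* y) y%:C) => [s s1 s2|t t1].
  apply: Fd; rewrite addrAC (le_lt_trans (le_normcD _ _))// normcM normc_real.
  have : normc s <= 2 by apply: (le_trans (normc_le _)); lra.
  have := normc_ge0 s; nra.
rewrite (_ : _ + _ = (x + y * t)%:C).
  apply: F0; rewrite addrAC (le_lt_trans (ler_normD _ _))// normrM.
  have := normr_ge0 t; nra.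
by apply/eqP; rewrite eq_complex /=; apply/andP; split; apply/eqP; ring.
Qed.

(** The set of points of the segment near which F vanishes is open and closed in it; it is
    closed because the radius in [disc_unique] does not depend on e. *)
Lemma segment_unique F c z :
  (forall t : R, 0 <= t <= 1 -> exists2 r : R, 0 < r &
     forall w, normc (w - (c + t%:C * (z - c))) < r -> cdifferentiable F w) ->
  (exists2 e : R, 0 < e & forall w, normc (w - c) < e -> F w = 0) -> F z = 0.
Proof.
move=> Fd [e0 e00 F0].
pose g (t : R) := c + t%:C * (z - c).
pose P (t : R) := exists2 e : R, 0 < e & forall w, normc (w - g t) < e -> F w = 0.
pose L := normc (z - c) + 1.
have L0 : 0 < L by rewrite ltr_wpDl// normc_ge0.
have gL s t : normc (g s - g t) <= `|s - t| * L.
  rewrite (_ : g s - g t = (s - t)%:C * (z - c)); last by rewrite /g rmorphB/=; ring.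
  by rewrite normcM normc_real ler_wpM2l// lerDl.
have P0 : P 0 by exists e0 => // w; rewrite /g mul0r addr0; exact: F0.
suff /(_ 1) H : forall t, 0 <= t <= 1 -> P t.
  have [|e e_gt0] := H; first by rewrite ler01 lexx.
  by apply; rewrite /g mul1r [c + _]addrC subrK subrr normc0.
pose B := `[0, 1]%classic `&` P.
suff BA : B = `[0, 1]%classic by move=> t t01; have [] : B t by rewrite BA/= in_itv.
apply: (@segment_connected R 0 1).
- by exists 0; split=> //=; rewrite in_itv/= lexx ler01.
- exists P => //; rewrite openE => t [e e_gt0 eP].
  exists (e / 2 / L) => /=; first by rewrite !divr_gt0.
  move=> s; rewrite /ball_/= distrC ltr_pdivlMr// => st.
  exists (e / 2) => [|w ws]; first by rewrite divr_gt0.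
  apply: eP; rewrite -[w](subrK (g s)) -addrA (le_lt_trans (le_normcD _ _))//.
  by have := gL s t; lra.
- exists (closure B); first exact: closed_closure.
  apply/seteqP; split => [t Bt|t [t01 Bt]].
    by split; [case: Bt|exact: subset_closure].
  split=> //; move: t01; rewrite /= in_itv/= => /Fd[r r0 rP].
  have [s [[_ [e e_gt0 eP]] st]] : B `&` ball t (r / 8 / L) !=set0.
    by apply: Bt; apply: nbhsx_ballx; rewrite !divr_gt0.
  move: st; rewrite /ball/= ltr_pdivlMr// => st.
  have ts := gL t s.
  exists (r / 4) => [|w wt]; first by rewrite divr_gt0.
  (* The disc of radius 7/8 r around g s lies in that of radius r around g t, and its half
     contains the disc of radius r / 4 around g t. *)
  apply: (@disc_unique _ F (g s) (7 / 8 * r) e) => // [v vs|].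
    apply: rP; rewrite -/(g t) -[v](subrK (g s)) -addrA (le_lt_trans (le_normcD _ _))//.
    by rewrite [normc (g s - _)]normc_sub; lra.
  rewrite -[w](subrK (g t)) -addrA (le_lt_trans (le_normcD _ _))//.
  by lra.
Qed.

End IdentityTheorem.

(** * Calculus of complex derivatives *)

Section ComplexPower.
Variable R : realType.
Local Open Scope complex_scope.
Local Notation C := (complex R).
Local Notation Re := (@complex.Re R).
Local Notation Im := (@complex.Im R).
Implicit Types (F G : C -> C) (z w c d D : C).

Lemma cderiv_near F G z D : (exists2 r : R, 0 < r & forall w, normc (w - z) < r -> F w = G w) ->
  is_cderiv G z D -> is_cderiv F z D.
Proof.
move=> [r r0 FG] GD e /GD[d d0 dP].
have FGz : F z = G z by apply: FG; rewrite subrr normc0.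
exists (Num.min r d) => [|w]; first by rewrite lt_min r0.
by rewrite lt_min => /andP[/FG-> /dP]; rewrite FGz.
Qed.

Lemma cderiv_cst c z : is_cderiv (fun=> c) z 0.
Proof.
move=> e e0; exists 1 => // w _.
by rewrite subrr mul0r subr0 normc0 mulr_ge0 ?normc_ge0// ltW.
Qed.

Lemma cderivD F G z D E : is_cderiv F z D -> is_cderiv G z E ->
  is_cderiv (fun w => F w + G w) z (D + E).
Proof.
move=> FD GE e e0; have e20 : 0 < e / 2 by rewrite divr_gt0.
have [d1 d10 d1P] := FD _ e20; have [d2 d20 d2P] := GE _ e20.
exists (Num.min d1 d2) => [|w]; first by rewrite lt_min d10.
rewrite lt_min => /andP[/d1P h1 /d2P h2].
rewrite (_ : _ - _ - _ = (F w - F z - D * (w - z)) + (G w - G z - E * (w - z))); last by ring.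
by rewrite (le_trans (le_normcD _ _))//; lra.
Qed.

Lemma cderiv_comp F G z D E : is_cderiv F z D -> is_cderiv G (F z) E ->
  is_cderiv (fun w => G (F w)) z (E * D).
Proof.
move=> FD GE e e0.
have D0 := normc_ge0 D; have E0 := normc_ge0 E.
have D1 : 0 < normc D + 1 by lra.
have E1 : 0 < normc E + 1 by lra.
have [d1 d10 d1P] := cderiv_lipschitz FD.
have [d2 d20 d2P] := GE (e / 2 / (normc D + 1)) ltac:(by rewrite !divr_gt0).
have [d3 d30 d3P] := FD (e / 2 / (normc E + 1)) ltac:(by rewrite !divr_gt0).
exists (Num.min (Num.min d1 d3) (d2 / (normc D + 1))) => [|w].
  by rewrite !lt_min d10 d30 divr_gt0.
rewrite !lt_min ltr_pdivlMr// => /andP[/andP[/d1P h1 /d3P h3] h2].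
have := d2P (F w) ltac:(by rewrite (le_lt_trans h1)// mulrC) => h4.
rewrite (_ : _ - _ - _ = (G (F w) - G (F z) - E * (F w - F z)) + E * (F w - F z - D * (w - z)));
  last by ring.
rewrite (le_trans (le_normcD _ _))// normcM.
rewrite [leRHS](_ : _ = e / 2 * normc (w - z) + e / 2 * normc (w - z)); last by field.
have n0 := normc_ge0 (w - z).
apply: lerD.
  apply: (le_trans h4); rewrite -mulrA ler_wpM2l ?divr_ge0 ?(ltW e0)//.
  by rewrite ler_pdivrMl.
apply: (@le_trans _ _ (normc E * (e / 2 / (normc E + 1) * normc (w - z)))).
  by rewrite ler_wpM2l.
rewrite mulrA ler_wpM2r// mulrCA ler_piMr ?divr_ge0 ?(ltW e0)// ler_pdivrMr// mul1r.
by rewrite lerDl.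
Qed.

Lemma cderiv_inv z : z != 0 -> is_cderiv (fun w => w^-1) z (- (z * z)^-1).
Proof.
move=> z0 e e0; have n0 : 0 < normc z by rewrite normc_gt0.
pose K := normc z ^+ 3.
have K0 : 0 < K by rewrite exprn_gt0.
exists (Num.min (normc z / 2) (e * K / 2)) => [|w].
  by rewrite lt_min !divr_gt0// mulr_gt0.
rewrite lt_min => /andP[h1 h2].
have nw : normc z / 2 <= normc w.
  have := le_normcD (z - w) w; rewrite subrK normc_sub; lra.
have w0 : w != 0 by rewrite -normc_gt0 (lt_le_trans _ nw)// divr_gt0.
have -> : w^-1 - z^-1 - - (z * z)^-1 * (w - z) = (w - z) * ((w - z) / (z * z * w)).
  by field; rewrite z0 w0.
rewrite normcM mulrC ler_wpM2r ?normc_ge0// normcM normcV !normcM.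
rewrite ler_pdivrMr ?mulr_gt0//; last by rewrite normc_gt0.
apply: (le_trans (ltW h2)).
have : e * K / 2 <= e * (normc z * normc z * (normc z / 2)).
  by rewrite /K !exprS expr0 mulr1; lra.
move=> /le_trans; apply; rewrite ler_wpM2l ?(ltW e0)// ler_wpM2l// mulr_ge0// ltW//.
Qed.

Lemma cderivX F z D n : is_cderiv F z D ->
  is_cderiv (fun w => F w ^+ n.+1) z (n.+1%:R * F z ^+ n * D).
Proof.
move=> FD; elim: n => [|n IHn].
  by rewrite expr0 mulr1 mul1r; apply: cderiv_near FD; exists 1.
apply: (@cderiv_near _ (fun w => F w * F w ^+ n.+1)).
  by exists 1 => // w _; rewrite -exprS.
rewrite (_ : _ * D = D * F z ^+ n.+1 + F z * (n.+1%:R * F z ^+ n * D)); first exact: cderivM.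
by rewrite -[n.+2%:R]natr1 !exprS; ring.
Qed.

Definition cexp z : C := (expR (Re z))%:C * (cos (Im z) +i* sin (Im z)).

Lemma cexp0 : cexp 0 = 1.
Proof. by rewrite /cexp /= expR0 cos0 sin0 mul1r. Qed.

(** Only the derivative at 0 is needed, since [cpow_near] moves every point to 1 and the
    logarithm of 1 is 0. *)
Lemma cderiv_cexp0 : is_cderiv cexp 0 1.
Proof.
move=> e e0.
have e40 : 0 < e / 8 by rewrite divr_gt0.
have little (f : R -> R) (D : R) : is_derive (0 : R) (1 : R) f D -> exists2 d : R, 0 < d &
    forall t, `|t| < d -> `|f t - f 0 - D * t| <= e / 8 * `|t|.
  move=> fD; have [d d0 dP] := derive_approx fD e40; exists d => // t td.
  by have := dP t; rewrite subr0 mulrC; apply.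
have [d1 d10 d1P] := little expR 1 ltac:(have := is_derive_expR (0 : R); rewrite expR0//).
have [d2 d20 d2P] := little cos 0 ltac:(have := is_derive_cos (0 : R); rewrite sin0 oppr0//).
have [d3 d30 d3P] := little sin 1 ltac:(have := is_derive_sin (0 : R); rewrite cos0//).
exists (Num.min (Num.min d1 d2) (Num.min d3 (Num.min 1 (e / 8)))) => [|[a b]].
  by rewrite !lt_min d10 d20 d30 ltr01 e40.
rewrite !lt_min subr0 cexp0 mul1r => /andP[/andP[h1 h2] /andP[h3 /andP[h4 h5]]].
set n := normc (a +i* b) in h1 h2 h3 h4 h5 *.
have na : `|a| <= n by exact: (normr_Re (a +i* b)).
have nb : `|b| <= n by exact: (normr_Im (a +i* b)).
have := d1P a (le_lt_trans na h1); rewrite expR0 mul1r => A.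
have := d2P b (le_lt_trans nb h2); rewrite cos0 mul0r subr0 => B.
have := d3P b (le_lt_trans nb h3); rewrite sin0 mul1r subr0 => S.
have cb : `|cos b| <= 1 by rewrite ler_norml cos_geN1 cos_le1.
have sb : `|sin b| <= 1 by rewrite ler_norml sin_geN1 sin_le1.
have a0 := normr_ge0 a; have b0 := normr_ge0 b.
apply: (le_trans (normc_le _)).
rewrite [Re _](_ : _ = (expR a - 1 - a) * cos b + (1 + a) * (cos b - 1)); last first.
  by rewrite /cexp /=; ring.
rewrite [Im _](_ : _ = (expR a - 1 - a) * sin b + a * sin b + (sin b - b)); last first.
  by rewrite /cexp /=; ring.
have E1 : `|(expR a - 1 - a) * cos b + (1 + a) * (cos b - 1)| <= e / 8 * n + 2 * (e / 8 * n).
  rewrite (le_trans (ler_normD _ _))// !normrM lerD//.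
    rewrite -[leRHS]mulr1 ler_pM// (le_trans A)// ler_wpM2l// ltW//.
  rewrite ler_pM//; last by rewrite (le_trans B)// ler_wpM2l// ltW.
  by rewrite (le_trans (ler_normD _ _))// normr1; lra.
have E2 : `|(expR a - 1 - a) * sin b + a * sin b + (sin b - b)| <=
    e / 8 * n + (e / 8 * n + e / 8 * n) + e / 8 * n.
  rewrite (le_trans (ler_normD _ _))// lerD//; last by rewrite (le_trans S)// ler_wpM2l// ltW.
  rewrite (le_trans (ler_normD _ _))// !normrM lerD//.
    rewrite -[leRHS]mulr1 ler_pM// (le_trans A)// ler_wpM2l// ltW//.
  have n0 : 0 <= n by lra.
  have sn : `|sin b| <= n + e / 8 * n.
    rewrite -[sin b](subrK b) (le_trans (ler_normD _ _))// addrC lerD// (le_trans S)//.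
    by rewrite ler_wpM2l// ltW.
  apply: (le_trans (ler_pM a0 (normr_ge0 _) na sn)); rewrite mulrDr lerD//.
    by rewrite ler_wpM2r// ltW.
  by rewrite mulrCA ler_wpM2l ?(ltW e40)// ler_piMl// ltW.
have en : 0 <= e * n by rewrite mulr_ge0 ?(ltW e0)//; lra.
by lra.
Qed.

End ComplexPower.

(** * Principal powers and truncated exponentials *)

Section PrincipalPower.
Variable R : realType.
Local Open Scope complex_scope.
Local Notation C := (complex R).
Local Notation Re := (@complex.Re R).
Local Notation Im := (@complex.Im R).
Implicit Types (F G : C -> C) (z w c d D : C).

Definition cpolar (r t : R) : C := r%:C * (cos t +i* sin t).

Lemma normc_cpolar (r t : R) : 0 <= r -> normc (cpolar r t) = r.
Proof.
move=> r0; rewrite normcM normc_real ger0_norm//.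
by rewrite /= cos2Dsin2 sqrtr1 mulr1.
Qed.

Lemma cpolarM (r r' t t' : R) : cpolar r t * cpolar r' t' = cpolar (r * r') (t + t').
Proof.
rewrite /cpolar cosD sinD rmorphM/=.
by apply/eqP; rewrite eq_complex /=; apply/andP; split; apply/eqP; ring.
Qed.

(** The principal logarithm on the right half plane. *)
Definition clog1 c : C := ln (normc c) +i* atan (Im c / Re c).

Lemma clog1_cpolar c : 0 < Re c -> c = cpolar (normc c) (atan (Im c / Re c)).
Proof.
move=> c0; have [cs tn] := (cos_atan (Im c / Re c), atanK (Im c / Re c)).
have n0 : 0 < normc c by rewrite (lt_le_trans c0)// (le_trans (ler_norm _))// normr_Re.
have E : normc c * cos (atan (Im c / Re c)) = Re c.
  rewrite cs; apply/eqP; rewrite -(@eqrXn2 _ 2) ?(ltW c0)//; last first.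
    by rewrite mulr_ge0 ?(ltW n0)// invr_ge0 sqrtr_ge0.
  rewrite exprMn exprVn sqr_sqrtr; last by rewrite addr_ge0// sqr_ge0.
  have a0 : Re c != 0 by rewrite gt_eqF.
  rewrite sqr_normc expr_div_n; apply/eqP; field; rewrite a0 /=.
  by rewrite gt_eqF// ltr_wpDr ?sqr_ge0// exprn_gt0.
have cn0 : cos (atan (Im c / Re c)) != 0.
  by apply/eqP => H; move: E c0; rewrite H mulr0 => <-; rewrite ltxx.
have S : normc c * sin (atan (Im c / Re c)) = Im c.
  have -> : sin (atan (Im c / Re c)) = Im c / Re c * cos (atan (Im c / Re c)).
    by move: tn; rewrite /tan => /(canRL (divfK cn0)).
  by rewrite mulrCA E divfK// gt_eqF.
move: E S; rewrite /cpolar; move: (cos _) (sin _) (normc c) => u v n.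
case: c {c0 cs tn n0 cn0} => a b /= <- <-.
by apply/eqP; rewrite eq_complex /=; apply/andP; split; apply/eqP; ring.
Qed.

Lemma cexp_clog1 c : 0 < Re c -> cexp (clog1 c) = c.
Proof.
move=> c0; rewrite [RHS]clog1_cpolar// /cexp /clog1 /= lnK// posrE.
by rewrite (lt_le_trans c0)// (le_trans (ler_norm _))// normr_Re.
Qed.

Lemma Re_gt0_near1 c : normc (c - 1) < 1 / 2 -> 1 / 2 < Re c.
Proof.
move=> c1; have := le_lt_trans (normr_Re _) c1; rewrite ReB /= ltr_norml => /andP[].
lra.
Qed.

Lemma clog1_cvg1 (e : R) : 0 < e -> exists2 d : R, 0 < d &
  forall c, normc (c - 1) < d -> normc (clog1 c) < e.
Proof.
move=> e0; have e20 : 0 < e / 2 by rewrite divr_gt0.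
have /cvgrPdist_lt /(_ _ e20)[d1 /= d10 d1P] := @continuous_ln R 1 ltr01.
have /cvgrPdist_lt /(_ _ e20)[d2 /= d20 d2P] := @continuous_atan R 0.
exists (Num.min (1 / 2) (Num.min d1 (d2 / 2))) => [|c].
  by rewrite !lt_min d10 !divr_gt0.
rewrite !lt_min => /andP[c1 /andP[cd1 cd2]].
have cr := Re_gt0_near1 c1.
have A : `|ln (normc c)| < e / 2.
  have := d1P (normc c); rewrite ln1 sub0r normrN; apply.
  rewrite /= -(normc1 R) (le_lt_trans _ cd1)//.
  have := le_normcD (c - 1) 1; have := le_normcD (1 - c) c.
  by rewrite !subrK normc_sub => h1 h2; rewrite ler_norml; apply/andP; split; lra.
have B : `|atan (Im c / Re c)| < e / 2.
  have := d2P (Im c / Re c); rewrite atan0 !sub0r !normrN; apply.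
  rewrite /= sub0r normrN normrM normfV [X in _ / X]gtr0_norm; last lra.
  rewrite ltr_pdivrMr; last lra.
  have : `|Im c| < d2 / 2.
    have := normr_Im (c - 1); rewrite ImB /= subr0 => /le_lt_trans; exact.
  nra.
by apply: (le_lt_trans (normc_le (clog1 c))); rewrite /=; lra.
Qed.

(** Derivative of an inverse function: as c - 1 = l + o(l) for l = log c, the modulus of l is
    at most twice that of c - 1. *)
Lemma cderiv_clog1 : is_cderiv clog1 1 1.
Proof.
move=> e e0; pose e' := Num.min (1 / 2) (e / 2).
have e'0 : 0 < e' by rewrite lt_min !divr_gt0.
have e'1 : e' <= 1 / 2 by rewrite ge_min lexx.
have e'2 : e' <= e / 2 by rewrite ge_min lexx orbT.
have [d d0 dP] := cderiv_cexp0 e'0.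
have [d' d'0 d'P] := clog1_cvg1 d0.
exists (Num.min (1 / 2) d') => [|c]; first by rewrite lt_min divr_gt0.
rewrite lt_min => /andP[c1 /d'P ld].
have cr := Re_gt0_near1 c1.
have -> : clog1 1 = 0.
  by rewrite /clog1 normc1 ln1 /= mul0r atan0.
have := dP (clog1 c); rewrite subr0 cexp0 mul1r cexp_clog1; last lra.
move=> /(_ ld) h; rewrite mul1r.
have n0 := normc_ge0 (clog1 c).
have h2 : normc (clog1 c) <= 2 * normc (c - 1).
  have := le_normcD (c - 1) (- (c - 1 - clog1 c)).
  rewrite normcN (_ : c - 1 - (c - 1 - clog1 c) = clog1 c); last by ring.
  nra.
rewrite (normc_sub (clog1 c)) (le_trans h)//.
have := normc_ge0 (c - 1); nra.
Qed.

Definition slitplane z := Im z != 0 \/ 0 < Re z.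

Definition carg z : R :=
  if 0 <= Im z then acos (Re z / normc z) else - acos (Re z / normc z).

Lemma carg_cpolar (r t : R) : 0 < r -> - pi < t < pi -> carg (cpolar r t) = t.
Proof.
move=> r0 /andP[t1 t2]; rewrite /carg normc_cpolar ?(ltW r0)//.
have -> : Re (cpolar r t) = r * cos t by rewrite /=; ring.
have -> : Im (cpolar r t) = r * sin t by rewrite /=; ring.
rewrite mulrAC divff ?gt_eqF// mul1r pmulr_rge0//.
have [t0|t0] := leP 0 t.
  by rewrite sin_ge0_pi ?t0 ?ltW// cosK// in_itv/= t0 ltW.
have : 0 < sin (- t) by apply: sin_gt0_pi; rewrite oppr_gt0 t0 ltrNl.
rewrite sinN oppr_gt0 ltNge => /negPf->.
by rewrite -cosN cosK ?opprK// in_itv/= oppr_ge0 ltW//= lerNl ltW.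
Qed.

Lemma slitplane_gt0 z : slitplane z -> 0 < normc z.
Proof.
case: z => a b; rewrite normc_gt0 eq_complex /slitplane /= negb_and => -[->|]; first by rewrite orbT.
by move=> /lt0r_neq0 ->.
Qed.

Lemma slitplane_neq0 z : slitplane z -> z != 0.
Proof. by move=> /slitplane_gt0; rewrite normc_gt0. Qed.

Lemma Re_div_norm z : -1 <= Re z / normc z <= 1.
Proof.
have [->|z0] := eqVneq z 0; first by rewrite mul0r lerN10 ler01.
by rewrite -ler_norml normrM normfV [X in _ / X]ger0_norm ?normc_ge0// ler_pdivrMr ?normc_gt0// mul1r normr_Re.
Qed.

Lemma carg_bound z : slitplane z -> - pi < carg z < pi.
Proof.
move=> zs; have n0 := slitplane_gt0 zs.
have /andP[c1 c2] := Re_div_norm z; have pi0 := pi_gt0 R.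
have a0 := acos_ge0 (Re_div_norm z).
have api : acos (Re z / normc z) < pi.
  apply: acos_ltpi; rewrite c2 andbT lt_neqAle c1 andbT; apply/eqP => E.
  have Rz : Re z = - normc z.
    by rewrite -[LHS](@divfK _ (normc z)) ?gt_eqF// -E mulN1r.
  have := sqr_normc z; rewrite Rz sqrrN => /eqP; rewrite -[X in X == _]addr0 (inj_eq (addrI _)).
  rewrite eq_sym sqrf_eq0 => /eqP Iz; case: zs; first by rewrite Iz eqxx.
  by rewrite Rz oppr_gt0 ltNge (ltW n0).
by rewrite /carg; case: ifP => _; apply/andP; split; lra.
Qed.

Lemma cpolar_carg z : z != 0 -> z = cpolar (normc z) (carg z).
Proof.
rewrite -normc_gt0 => n0; have nn : normc z != 0 by rewrite gt_eqF.
have E1 : normc z * cos (carg z) = Re z.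
  rewrite (_ : cos (carg z) = Re z / normc z); first by rewrite mulrC divfK.
  by rewrite /carg; case: ifP => _; rewrite ?cosN acosK// in_itv/= Re_div_norm.
have E2 : normc z * sin (carg z) = Im z.
  have E : normc z * sin (acos (Re z / normc z)) = `|Im z|.
    rewrite sin_acos ?Re_div_norm// -[X in X * _](@ger0_norm _ (normc z)) ?ltW//.
    rewrite -sqrtr_sqr -sqrtrM ?sqr_ge0// mulrBr mulr1 -exprMn mulrC divfK//.
    by rewrite sqr_normc addrAC subrr add0r sqrtr_sqr.
  by rewrite /carg; case: leP => h; [rewrite E ger0_norm|rewrite sinN mulrN E ltr0_norm// opprK].
move: E1 E2; rewrite /cpolar; move: (cos _) (sin _) (normc z) => u v n.
by case: z {n0 nn} => a b /= <- <-;
  apply/eqP; rewrite eq_complex /=; apply/andP; split; apply/eqP; ring.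
Qed.

Variable a : R.

Definition cpow z : C := cpolar (normc z `^ a) (a * carg z).

Lemma cpow_cpolar (r t : R) : 0 < r -> - pi < t < pi ->
  cpow (cpolar r t) = cpolar (r `^ a) (a * t).
Proof. by move=> r0 tpi; rewrite /cpow carg_cpolar// normc_cpolar// ltW. Qed.

Lemma normc_cpow z : normc (cpow z) = normc z `^ a.
Proof. by rewrite normc_cpolar// powR_ge0. Qed.

Lemma cpow_neq0 z : z != 0 -> cpow z != 0.
Proof. by rewrite -!normc_gt0 normc_cpow; exact: powR_gt0. Qed.

(** The principal argument is defined by cases, but close to z it is that of z plus the
    argument of w / z, which lies in the right half plane. This makes the power
    differentiable across the positive axis, where the cases meet. *)
Lemma cpow_near z : slitplane z -> exists2 d : R, 0 < d & forall w, normc (w - z) < d ->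
  cpow w = cpow z * cexp (a%:C * clog1 (0 + z^-1 * w)).
Proof.
move=> zs; have z0 := slitplane_neq0 zs; have n0 := slitplane_gt0 zs.
have /andP[t1 t2] := carg_bound zs.
(* The argument of w / z will be less than e, so that its sum with the argument of z is
   again a principal argument. *)
pose e := Num.min (pi - carg z) (pi + carg z).
have e0 : 0 < e by rewrite lt_min; apply/andP; split; lra.
have e1 : e <= pi - carg z by rewrite ge_min lexx.
have e2 : e <= pi + carg z by rewrite ge_min lexx orbT.
have [d d0 dP] := clog1_cvg1 e0.
exists (normc z * Num.min d (1 / 2)) => [|w].
  by rewrite mulr_gt0// lt_min d0 divr_gt0.
rewrite add0r; set c := z^-1 * w => wz.
have wE : w = z * c by rewrite /c mulrA divff// mul1r.
have : normc (c - 1) < Num.min d (1 / 2).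
  move: wz; rewrite [X in normc (X - _)]wE -[X in _ - X]mulr1 -mulrBr normcM.
  by rewrite ltr_pM2l.
rewrite lt_min => /andP[/dP ce /Re_gt0_near1 c1].
have c0 : 0 < Re c by lra.
have nc0 : 0 < normc c by rewrite (lt_le_trans c0)// (le_trans (ler_norm _))// normr_Re.
set t := atan (Im c / Re c).
have te : `|t| < e by rewrite (le_lt_trans _ ce)//; exact: (normr_Im (clog1 c)).
have -> : cexp (a%:C * clog1 c) = cpolar (normc c `^ a) (a * t).
  by rewrite /cexp /clog1 /= !mul0r subr0 addr0 /powR (gt_eqF nc0).
have -> : cpow w = cpolar ((normc z * normc c) `^ a) (a * (carg z + t)).
  rewrite -cpow_cpolar ?mulr_gt0//; last first.
    by move: te; rewrite ltr_norml => /andP[? ?]; apply/andP; split; lra.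
  by rewrite -cpolarM -cpolar_carg// -clog1_cpolar// -wE.
by rewrite /cpow cpolarM powRM ?normc_ge0// mulrDr.
Qed.

Lemma cderiv_cpow z : slitplane z -> is_cderiv cpow z (a%:C * cpow z / z).
Proof.
move=> zs; have z0 := slitplane_neq0 zs.
apply: cderiv_near (cpow_near zs) _.
have L : is_cderiv (fun w => clog1 (0 + z^-1 * w)) z (1 * z^-1).
  apply: cderiv_affine; rewrite add0r mulVf//; exact: cderiv_clog1.
have zz : clog1 (0 + z^-1 * z) = 0.
  by rewrite add0r mulVf// /clog1 normc1 ln1 /= mul0r atan0.
have M c F D : is_cderiv F z D -> is_cderiv (fun w => c * F w) z (c * D).
  by move=> FD; rewrite -[c * D]add0r -(mul0r (F z)); apply: cderivM => //; exact: cderiv_cst.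
have := @cderiv_comp R _ (@cexp R) z _ 1 (M a%:C _ _ L).
rewrite zz mulr0 => /(_ (@cderiv_cexp0 R)) /(M (cpow z)).
by congr (is_cderiv _ _ _); rewrite mul1r mulrA mulrC !mulrA; ring.
Qed.

Definition ctrunc_exp (k : nat) (p : C) : C := \sum_(n < k.+1) (n`!%:R)^-1 * p ^+ n.

Lemma cderiv_ctrunc_exp k (F : C -> C) z D : is_cderiv F z D ->
  is_cderiv (fun w => ctrunc_exp k.+1 (F w)) z (ctrunc_exp k (F z) * D).
Proof.
move=> FD.
have M c G E : is_cderiv G z E -> is_cderiv (fun w => c * G w) z (c * E).
  by move=> GE; rewrite -[c * E]add0r -(mul0r (G z)); apply: cderivM => //; exact: cderiv_cst.
have step n : is_cderiv (fun w => (n.+1`!%:R)^-1 * F w ^+ n.+1) z ((n`!%:R)^-1 * F z ^+ n * D).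
  have := M (n.+1`!%:R)^-1 _ _ (cderivX n FD).
  congr (is_cderiv _ _ _); rewrite factS natrM.
  have n1 : n.+1%:R != 0 :> C by rewrite pnatr_eq0.
  have n2 : n`!%:R != 0 :> C by rewrite pnatr_eq0 -lt0n fact_gt0.
  by move: (n.+1%:R) (n`!%:R) n1 n2 => x y x0 y0; field; rewrite x0 y0.
elim: k => [|k IHk].
  rewrite /ctrunc_exp big_ord1 -[X in is_cderiv _ _ X]add0r.
  apply: (@cderiv_near _ _ (fun w => (0`!%:R)^-1 + (1`!%:R)^-1 * F w ^+ 1)).
    by exists 1 => // w _; rewrite big_ord_recr big_ord1/= expr0 mulr1.
  by apply: cderivD; [exact: cderiv_cst|exact: step].
rewrite {2}/ctrunc_exp big_ord_recr/= mulrDl.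
apply: (@cderiv_near _ _ (fun w => ctrunc_exp k.+1 (F w) + (k.+2`!%:R)^-1 * F w ^+ k.+2)).
  by exists 1 => // w _; rewrite {1}/ctrunc_exp big_ord_recr.
by apply: cderivD; [exact: IHk|exact: step].
Qed.

End PrincipalPower.

(** * The planes C(I) *)

Section SlicePlane.
Variable R : realType.
Local Open Scope complex_scope.
Local Notation C := (complex R).
Local Notation H := (quat R).
Local Notation Re := (@complex.Re R).
Local Notation Im := (@complex.Im R).
Variables (I : H) (IS : imag_sphere R I).
Implicit Types (z w : C) (p q : H).

Lemma imag_sphereE : qr I = 0 /\ qi I ^+ 2 + qj I ^+ 2 + qk I ^+ 2 = 1.
Proof.
have [I0 I1] := IS; split => //.
have : quat_sqnorm I = 1.
  by rewrite -[LHS]sqr_sqrtr ?quat_sqnorm_ge0// -/(quat_norm I) -quat_normE I1 expr1n.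
by rewrite /quat_sqnorm I0 expr0n /= add0r.
Qed.

Definition slice z : H := slice_pt I (Re z, Im z).

Lemma sliceE z : slice z = Quat (Re z) (Im z * qi I) (Im z * qj I) (Im z * qk I).
Proof. by rewrite /slice slice_ptE; case: imag_sphereE. Qed.

Lemma imag_sphere_sqr : I * I = -1.
Proof.
have [I0 I1] := imag_sphereE; apply: quatP; rewrite /= I0; try ring.
by rewrite -[in RHS]I1; ring.
Qed.

Lemma sliceD z w : slice (z + w) = slice z + slice w.
Proof. by case: z => a b; case: w => c d; rewrite !sliceE; apply: quatP => /=; ring. Qed.

Lemma sliceN z : slice (- z) = - slice z.
Proof. by case: z => a b; rewrite !sliceE; apply: quatP => /=; ring. Qed.

Lemma sliceB z w : slice (z - w) = slice z - slice w.
Proof. by rewrite sliceD sliceN. Qed.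

Lemma sliceM z w : slice (z * w) = slice z * slice w.
Proof.
case: z => a b; case: w => c d; rewrite /slice /slice_pt /=.
rewrite !mulrDr !mulrDl -!scalerAl -!scalerAr !mul1r !mulr1 imag_sphere_sqr !scalerA.
rewrite scalerBl !scalerDl scalerN -!addrA; congr (_ + _).
by rewrite addrC -addrA addrCA.
Qed.

Lemma slice_real (x : R) : slice x%:C = x%:A.
Proof. by rewrite /slice /slice_pt /= scale0r addr0. Qed.

Lemma slice1 : slice 1 = 1.
Proof. by rewrite (slice_real 1) scale1r. Qed.

Lemma slice0 : slice 0 = 0.
Proof. by rewrite (slice_real 0) scale0r. Qed.

Lemma slice_scale (x : R) z : slice (x%:C * z) = x *: slice z.
Proof. by rewrite sliceM slice_real -scalerAl mul1r. Qed.

Lemma sliceX z n : slice (z ^+ n) = slice z ^+ n.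
Proof. by elim: n => [|n IHn]; rewrite ?slice1// !exprS sliceM IHn. Qed.

Lemma slice_sum n (F : 'I_n -> C) : slice (\sum_(i < n) F i) = \sum_(i < n) slice (F i).
Proof. by apply: (big_morph slice sliceD slice0). Qed.

Lemma slice_norm z : `|slice z| = normc z.
Proof.
have [I0 I1] := imag_sphereE.
rewrite quat_normE /quat_norm sliceE /quat_sqnorm /=; case: z => a b /=.
by congr Num.sqrt; rewrite -[in RHS](mulr1 (b ^+ 2)) -I1; ring.
Qed.

Lemma slice_inj : injective slice.
Proof.
move=> z w zw; apply/eqP; rewrite -subr_eq0; apply/eqP.
by apply: eq0_normc; rewrite -slice_norm sliceB zw subrr normr0.
Qed.

Lemma sliceV z : slice z^-1 = (slice z)^-1.
Proof.
have [->|z0] := eqVneq z 0; first by rewrite invr0 slice0 invr0.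
have sz : slice z \is a GRing.unit.
  by rewrite quat_unitE -normr_eq0 slice_norm gt_eqF// normc_gt0.
by apply: (mulrI sz); rewrite mulrV// -sliceM divff// slice1.
Qed.

Definition slitdisc z := normc z < 1 /\ slitplane z.

Lemma Edom_slice z : Edom R (slice z) <-> slitdisc z.
Proof.
have [I0 I1] := imag_sphereE.
rewrite /Edom /Bdom /setD /= slice_norm /slitdisc; split=> -[z1 h]; split=> //.
  rewrite /slitplane; case: eqVneq => Iz; last by left.
  right; rewrite ltNge; apply/negP => Rz; apply: h.
  exists (Re z); last by case: z Iz {z1 Rz} => a b /= ->; rewrite (slice_real a).
  rewrite /= Rz andbT ltNge; apply/negP => Rz1; move: z1; apply/negP; rewrite -leNgt.
  apply: le_trans (normr_Re z); rewrite ler0_norm//; lra.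
move=> [x /= /andP[x1 x0] /esym]; rewrite -slice_real => /slice_inj zx.
by case: h; rewrite zx /= ?eqxx// ltNge x0.
Qed.

Lemma Eslice_slice z : slitdisc z -> Eslice I (slice z).
Proof. by move=> /Edom_slice zE; split=> //; exists (Re z, Im z). Qed.

Lemma EsliceP q : Eslice I q -> exists2 z, slitdisc z & q = slice z.
Proof.
move=> [qE [[x y] _ E]]; have qz : q = slice (x +i* y) by rewrite -E.
by exists (x +i* y) => //; apply/Edom_slice; rewrite -qz.
Qed.

Lemma slitdisc_open z : slitdisc z ->
  exists2 d : R, 0 < d & forall w, normc (w - z) < d -> slitdisc w.
Proof.
move=> [z1 zs].
have [d d0 dP] : exists2 d : R, 0 < d & forall w, normc (w - z) < d -> slitplane w.
  case: zs => [Iz|Rz].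
    exists `|Im z|; first by rewrite normr_gt0.
    move=> w wz; left; apply/eqP => Iw; have := le_lt_trans (normr_Im _) wz.
    by rewrite ImB Iw sub0r normrN ltxx.
  exists (Re z) => // w wz; right; have := le_lt_trans (normr_Re _) wz.
  by rewrite ReB ltr_norml => /andP[]; lra.
exists (Num.min d (1 - normc z)) => [|w]; first by rewrite lt_min d0; lra.
rewrite lt_min => /andP[/dP ws wz]; split=> //.
by have := le_normcD (w - z) z; rewrite subrK; lra.
Qed.

Lemma qpow_slice (a : R) z : slitplane z -> qpow a (slice z) = slice (cpow a z).
Proof.
move=> zs; have E (r t : R) : slice (cpolar r t) = r *: slice_pt I (cos t, sin t).
  by rewrite /cpolar slice_scale.
rewrite {1}(cpolar_carg (slitplane_neq0 zs)) E qpow_polar//.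
- by rewrite -E.
- exact: slitplane_gt0.
- exact: carg_bound.
Qed.

Lemma trunc_exp_slice k z : trunc_exp k (slice z) = slice (ctrunc_exp k z).
Proof.
rewrite /ctrunc_exp slice_sum; apply: eq_bigr => n _.
by rewrite -sliceX -slice_scale fmorphV rmorph_nat.
Qed.

End SlicePlane.

(** * The right module of slice regular functions *)

Section SliceRegularModule.
Variable R : realType.
Local Open Scope complex_scope.
Local Notation C := (complex R).
Local Notation H := (quat R).
Local Notation Re := (@complex.Re R).
Local Notation Im := (@complex.Im R).
Implicit Types (z w : C) (p q D : H) (g : C -> H) (f : Efun R).

Lemma EextP f q : (exists2 x : Edom R, q = set_val x & Eext f q = f x) \/
  (~ Edom R q /\ Eext f q = 0).
Proof.
have [qE|qE] := pselect (Edom R q); last first.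
  right; split=> //; rewrite /Eext /valL_ /= oinv_set_val insubN//=.
  by rewrite notin_setE.
by left; exists (SigSub (mem_set qE)) => //; rewrite -EextE.
Qed.

Lemma Eext_lin (c : H^c) f1 f2 q : Eext (c *: f1 + f2) q = Eext f1 q * (c : H) + Eext f2 q.
Proof.
have [[x -> _]|[qE _]] := EextP f1 q; first by rewrite !EextE.
have out (f : Efun R) : Eext f q = 0.
  by have [[x qx _]|[_ //]] := EextP f q; case: qE; rewrite qx; exact: set_valP.
by rewrite !out mul0r addr0.
Qed.

Lemma Eext0 q : Eext (0 : Efun R) q = 0.
Proof. by have [[x -> _]|[]//] := EextP 0 q; rewrite EextE. Qed.

Definition rmul (c q : H) : H := q * c.

Lemma rmul_linear (c : H) : linear (rmul c).
Proof. by move=> a p q; rewrite /rmul mulrDl scalerAl. Qed.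

HB.instance Definition _ (c : H) := GRing.isLinear.Build R H H _ (rmul c) (rmul_linear c).

Lemma rmul_continuous (c : H) : continuous (rmul c).
Proof.
apply: bounded_linear_continuous; apply/linear_boundedP.
exists `|c|; split; first exact: normr_real.
move=> r cr q; rewrite /rmul quat_normM mulrC ler_wpM2r// ltW//.
Qed.

Lemma differentiable_lin (g1 g2 : H -> H) (c q : H) : differentiable g1 q -> differentiable g2 q ->
  differentiable (fun p => g1 p * c + g2 p) q.
Proof.
move=> d1 d2.
have d1c : differentiable (rmul c \o g1) q.
  by apply: differentiable_comp => //; apply: linear_differentiable; exact: rmul_continuous.
exact: (differentiableD d1c d2).
Qed.

Lemma derive_lin (g1 g2 : H -> H) (c q v : H) : differentiable g1 q -> differentiable g2 q ->
  derive (fun p => g1 p * c + g2 p) q v = derive g1 q v * c + derive g2 q v.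
Proof.
move=> d1 d2.
have dc : differentiable (rmul c) (g1 q) by apply: linear_differentiable; exact: rmul_continuous.
have d1c : differentiable (rmul c \o g1) q by exact: differentiable_comp.
have e0 : derive (fun p => g1 p * c + g2 p) q v = derive (rmul c \o g1) q v + derive g2 q v.
  by apply: (@deriveD _ _ _ (rmul c \o g1) g2); exact: diff_derivable.
have e2 : derive (rmul c \o g1) q v = 'd (rmul c) (g1 q) ('d g1 q v).
  by rewrite deriveE//; have /(congr1 (@^~ v)) := diff_comp d1 dc.
have e3 : 'd (rmul c) (g1 q) ('d g1 q v) = 'd g1 q v * c.
  by have /(congr1 (@^~ ('d g1 q v))) := diff_lin (g1 q) (@rmul_continuous c).
have e4 : derive g1 q v = 'd g1 q v by exact: deriveE.
by rewrite e0 e4; congr (_ + _); exact: (etrans e2 e3).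
Qed.

Lemma derive1_slicel (g : H -> H) I (x y : R) :
  derive1 (fun t : R => g (slice_pt I (t, y))) x = derive g (slice_pt I (x, y)) (1 : H).
Proof.
rewrite /derive1 /derive; set u := (fun h => _); set v := (fun h => _).
suff -> : u = v by [].
by rewrite /u /v /slice_pt /=; apply/funext => h; rewrite scalerDl addrA.
Qed.

Lemma derive1_slicer (g : H -> H) I (x y : R) :
  derive1 (fun t : R => g (slice_pt I (x, t))) y = derive g (slice_pt I (x, y)) I.
Proof.
rewrite /derive1 /derive; set u := (fun h => _); set v := (fun h => _).
suff -> : u = v by [].
by rewrite /u /v /slice_pt /=; apply/funext => h; rewrite scalerDl addrCA.
Qed.

Lemma slice_regular_lin (c : H^c) f1 f2 : slice_regular f1 -> slice_regular f2 ->
  slice_regular (c *: f1 + f2).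
Proof.
move=> [d1 r1] [d2 r2].
have lin (I a1 b1 a2 b2 : H) : a1 + I * b1 = 0 -> a2 + I * b2 = 0 ->
    a1 * (c : H) + a2 + I * (b1 * (c : H) + b2) = 0.
  by move=> e1 e2; rewrite mulrDr addrACA mulrA -mulrDl e1 e2 mul0r addr0.
have E : Eext (c *: f1 + f2) = (fun q => Eext f1 q * (c : H) + Eext f2 q).
  by apply/funext => q; exact: Eext_lin.
split=> [q qE|I IS x y xyE]; rewrite E.
  exact: differentiable_lin (d1 q qE) (d2 q qE).
have := r1 I IS x y xyE; have := r2 I IS x y xyE.
rewrite !derive1_slicel !derive1_slicer => e2 e1.
rewrite (derive1_slicel (fun q => Eext f1 q * (c : H) + Eext f2 q)).
rewrite (derive1_slicer (fun q => Eext f1 q * (c : H) + Eext f2 q)).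
have D1 := d1 _ xyE; have D2 := d2 _ xyE.
rewrite (derive_lin c 1 D1 D2) (derive_lin c I D1 D2).
exact: lin.
Qed.

Lemma slice_regular0 : slice_regular (0 : Efun R).
Proof.
have E : Eext (0 : Efun R) = cst 0 by apply/funext => q; exact: Eext0.
split=> [q _|I _ x y _]; rewrite E; first exact: differentiable_cst.
have e1 v : derive (cst 0 : H -> H) (slice_pt I (x, y)) v = 0 by exact: derive_cst.
by rewrite (derive1_slicel (cst 0)) (derive1_slicer (cst 0)) !e1 mulr0 addr0.
Qed.

End SliceRegularModule.

(** * Derivatives along a slice *)

Section SliceDerivative.
Variable R : realType.
Local Open Scope complex_scope.
Local Notation C := (complex R).
Local Notation H := (quat R).
Local Notation Re := (@complex.Re R).
Local Notation Im := (@complex.Im R).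
Variables (I : H) (IS : imag_sphere R I).
Implicit Types (z w : C) (p q D : H) (g : C -> H) (f : Efun R).
Local Notation slice := (slice I).

(** The increment acts on the left, as in the Cauchy-Riemann operator of slice regularity. *)
Definition is_sderiv g z D := forall e : R, 0 < e -> exists2 d : R, 0 < d &
  forall w, normc (w - z) < d ->
    `|g w - g z - slice (w - z) * D| <= e * normc (w - z).

Lemma differentiable_approx (g : H -> H) q : differentiable g q ->
  forall e : R, 0 < e -> exists2 d : R, 0 < d & forall h, `|h| < d ->
    `|g (h + q) - g q - 'd g q h| <= e * `|h|.
Proof.
move=> gd e e0; have /eqaddoP /(_ e e0) := diff_locally gd.
move=> /nbhs_normP[d /= d0 dP]; exists d => // h hd.
have := dP h; rewrite /= sub0r normrN => /(_ hd).
by rewrite opprD addrA.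
Qed.

(** The Cauchy-Riemann equation says that the differential L satisfies L I = I (L 1), so that
    L c = c (L 1) for every c in C(I). *)
Lemma slice_regular_sderiv f z : slice_regular f -> slitdisc z ->
  is_sderiv (fun w => Eext f (slice w)) z ('d (Eext f) (slice z) 1).
Proof.
move=> [fd fr] zd; have zE : Edom R (slice z) by apply/(Edom_slice IS).
have dfz := fd _ zE; set L := 'd (Eext f) (slice z).
have LI : L I = I * L 1.
  have := fr I IS (Re z) (Im z) zE.
  have -> : derive1 (fun t : R => Eext f (slice_pt I (t, Im z))) (Re z) = L 1.
    by rewrite (derive1_slicel (Eext f)); exact: deriveE.
  have -> : derive1 (fun t : R => Eext f (slice_pt I (Re z, t))) (Im z) = L I.
    by rewrite (derive1_slicer (Eext f)); exact: deriveE.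
  move=> /(congr1 ( *%R I)); rewrite mulr0 mulrDr mulrA imag_sphere_sqr// mulN1r.
  by move/eqP; rewrite subr_eq0 => /eqP <-.
move=> e e0; have [d d0 dP] := differentiable_approx dfz e0.
exists d => // w wz; have := dP (slice (w - z)); rewrite slice_norm// => /(_ wz).
rewrite {1}sliceB// subrK.
suff -> : 'd (Eext f) (slice z) (slice (w - z)) = slice (w - z) * L 1 by [].
rewrite -/L /slice /slice_pt /= linearD !linearZ/= LI.
by rewrite mulrDl -!scalerAl mul1r.
Qed.

Lemma sderiv_cvg g z D : is_sderiv g z D -> forall e : R, 0 < e ->
  exists2 d : R, 0 < d & forall w, normc (w - z) < d -> `|g w - g z| < e.
Proof.
move=> /(_ 1 ltr01)[d d0 dP] e e0.
have D1 : 0 < `|D| + 1 by rewrite ltr_wpDl.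
exists (Num.min d (e / (`|D| + 1))) => [|w]; first by rewrite lt_min d0 divr_gt0.
rewrite lt_min ltr_pdivlMr// => /andP[/dP h1 h2].
rewrite -[g w - g z](subrK (slice (w - z) * D)).
apply: le_lt_trans h2; rewrite (le_trans (ler_normD _ _))// quat_normM slice_norm//.
by rewrite mulrDr mulr1 addrC lerD2l -[leRHS]mul1r.
Qed.

(** The quotient rule for the two first order expansions; for w near z the increment of E is at
    least |E'| |w - z| / 2. *)
Lemma sderiv_ratio g (E : C -> C) z D (E' : C) : is_sderiv g z D -> is_cderiv E z E' -> E' != 0 ->
  forall e : R, 0 < e -> exists2 d : R, 0 < d & forall w, w != z -> normc (w - z) < d ->
    `|(slice (E z) - slice (E w))^-1 * (g z - g w) - (slice E')^-1 * D| < e.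
Proof.
move=> gD EE' E'0 e e0; have n0 : 0 < normc E' by rewrite normc_gt0.
pose K := 1 + `|D| / normc E'.
have K0 : 0 < K by rewrite ltr_wpDr// divr_ge0// ltW.
pose e' := Num.min (normc E' / 2) (e * normc E' / (4 * K)).
have e'0 : 0 < e' by rewrite lt_min !divr_gt0// !mulr_gt0.
have e'1 : e' <= normc E' / 2 by rewrite ge_min lexx.
have e'2 : e' <= e * normc E' / (4 * K) by rewrite ge_min lexx orbT.
have [d1 d10 d1P] := gD _ e'0; have [d2 d20 d2P] := EE' _ e'0.
exists (Num.min d1 d2) => [|w wz]; first by rewrite lt_min d10.
rewrite lt_min => /andP[/d1P h1 /d2P h2].
set h := w - z in h1 h2; have h0 : 0 < normc h by rewrite normc_gt0 subr_eq0.
have sE : slice E' \is a GRing.unit by rewrite quat_unitE -normr_eq0 slice_norm// gt_eqF.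
set a := E w - E z in h2.
have na : normc E' / 2 * normc h <= normc a.
  have := le_normcD (a) (E' * h - a); rewrite addrC subrK normcM [normc (E' * h - a)]normc_sub.
  nra.
have a0 : 0 < normc a by rewrite (lt_le_trans _ na)// mulr_gt0// divr_gt0.
have sa : slice a \is a GRing.unit by rewrite quat_unitE -normr_eq0 slice_norm// gt_eqF.
rewrite -(opprB (slice (E w))) -(opprB (g w)) invrN mulrNN -sliceB// -/a.
have aE : slice a / slice E' = slice h + slice (a - E' * h) / slice E'.
  by rewrite -sliceV// -!sliceM// -sliceD//; congr slice; field.
have -> : (slice a)^-1 * (g w - g z) - (slice E')^-1 * D =
    (slice a)^-1 * ((g w - g z - slice h * D) - slice (a - E' * h) / slice E' * D).
  rewrite -[in RHS]addrA -opprD -mulrDl -aE [RHS]mulrBr; congr (_ - _).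
  by rewrite !mulrA mulVr// mul1r.
rewrite quat_normM quat_normV slice_norm// mulrC ltr_pdivrMr//.
apply: (le_lt_trans (ler_normB _ _)); rewrite !quat_normM quat_normV !slice_norm//.
apply: (@le_lt_trans _ _ (e' * normc h + e' * normc h / normc E' * `|D|)).
  by rewrite lerD// !ler_wpM2r// invr_ge0 ltW.
rewrite (_ : _ + _ = e' * K * normc h); last by rewrite /K; ring.
apply: (@lt_le_trans _ _ (e * (normc E' / 2 * normc h))); last by rewrite ler_pM2l.
rewrite mulrA ltr_pM2r//.
apply: (@le_lt_trans _ _ (e * normc E' / (4 * K) * K)); first by rewrite ler_pM2r.
rewrite [X in X < _](_ : _ = e * normc E' / 4); last by field; rewrite gt_eqF.
have : 0 < e * normc E' by rewrite mulr_gt0.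
by lra.
Qed.

Lemma within_slice_proper z : slitdisc z -> ProperFilter (within (Eslice I) (slice z)^').
Proof.
move=> zd; have [d d0 dP] := slitdisc_open zd.
apply: Build_ProperFilter_ex => P; rewrite /within /dnbhs /= => /nbhs_normP[e /= e0 eP].
pose r := Num.min d e / 2.
have r0 : 0 < r by rewrite divr_gt0// lt_min d0.
have rd : r < d by have : Num.min d e <= d by [rewrite ge_min lexx]; rewrite /r in r0 *; lra.
have re : r < e by have : Num.min d e <= e by [rewrite ge_min lexx orbT]; rewrite /r in r0 *; lra.
have nr : normc (z + r%:C - z) = r by rewrite addrC addKr normc_real gtr0_norm.
exists (slice (z + r%:C)); apply: eP.
- by rewrite /= -sliceB// slice_norm// normc_sub nr.
- apply/eqP => /(slice_inj IS) /(congr1 (fun w => normc (w - z))).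
  by rewrite nr subrr normc0 => r00; rewrite r00 ltxx in r0.
- by apply: Eslice_slice => //; apply: dP; rewrite nr.
Qed.

Definition ek_pow (a : R) (k : nat) z : C := ctrunc_exp k (cpow a z).

(** The derivative of [ek_pow a k] when k >= 1, that of z^a being a z^a / z. *)
Definition ek_pow' (a : R) (k : nat) z : C := ctrunc_exp k.-1 (cpow a z) * (a%:C * cpow a z / z).

Lemma frac_deriv_slice (s a : R) k f z D : slitdisc z -> (1 <= k)%N ->
  is_sderiv (fun w => Eext f (slice w)) z D -> ek_pow' a k z != 0 ->
  frac_deriv s a k I f (slice z) =
    (1 - s) *: Eext f (slice z) + s *: ((slice (ek_pow' a k z))^-1 * D).
Proof.
move=> zd k1 fD E'0; rewrite /frac_deriv; congr (_ + _ *: _).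
have ED : is_cderiv (ek_pow a k) z (ek_pow' a k z).
  case: k k1 E'0 => // k _ E'0.
  by apply: cderiv_ctrunc_exp; apply: cderiv_cpow; case: zd.
have PF := within_slice_proper zd.
apply: cvg_lim; first exact: norm_hausdorff.
apply/cvgrPdist_lt => e e0.
have [d d0 dP] := sderiv_ratio fD ED E'0 e0.
rewrite /within /dnbhs /=; apply/nbhs_normP; exists d => //= q zq qz /(EsliceP IS)[w wd qw].
rewrite qw in zq qz *; rewrite distrC.
have wz : w != z by apply: contra_neq qz => ->.
have zs : slitplane z by case: zd.
have ws : slitplane w by case: wd.
rewrite !(qpow_slice IS)// !(trunc_exp_slice IS)//.
apply: (dP w wz); rewrite -(slice_norm IS) (sliceB IS) distrC; exact: zq.
Qed.

End SliceDerivative.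

(** * Measurability in the plane *)

Section PlaneMeasurability.
Variable R : realType.
Local Notation H := (quat R).

Definition plane_open (U : set (R * R)) := forall w, U w -> exists2 d : R, 0 < d &
  forall v : R * R, `|v.1 - w.1| < d -> `|v.2 - w.2| < d -> U v.

(** Such a set is a countable union of boxes with rational centre and radius 1 / (n + 1). *)
Lemma plane_open_measurable (U : set (R * R)) : plane_open U -> measurable U.
Proof.
move=> oU.
pose box (p q : rat) (n : nat) : set (R * R) :=
  `]ratr p - n.+1%:R^-1, ratr p + n.+1%:R^-1[%classic `*`
  `]ratr q - n.+1%:R^-1, ratr q + n.+1%:R^-1[%classic.
have mbox p q n : measurable (box p q n) by exact: measurableX.
have -> : U = \bigcup_(p : rat) \bigcup_(q : rat) \bigcup_n
    (if asbool (box p q n `<=` U) then box p q n else set0).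
  apply/seteqP; split=> [w Uw|w [p _ [q _ [n _]]]]; last by case: asboolP => // h /h.
  have [d d0 dP] := oU w Uw.
  pose n := Num.bound (2 / d).
  have nd : n.+1%:R^-1 < d / 2.
    rewrite invf_plt ?posrE ?divr_gt0// invf_div.
    have : 2 / d < n%:R by apply: archi_boundP; rewrite divr_ge0// ltW.
    by move=> /lt_le_trans; apply; rewrite ler_nat.
  have n0 : 0 < n.+1%:R^-1 :> R by rewrite invr_gt0.
  have lt (a r : R) : 0 < r -> a - r < a + r by lra.
  have [p] := @rat_in_itvoo R (w.1 - n.+1%:R^-1) (w.1 + n.+1%:R^-1) (lt _ _ n0).
  rewrite in_itv/= => /andP[p1 p2].
  have [q] := @rat_in_itvoo R (w.2 - n.+1%:R^-1) (w.2 + n.+1%:R^-1) (lt _ _ n0).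
  rewrite in_itv/= => /andP[q1 q2].
  exists p => //; exists q => //; exists n => //.
  rewrite /box; move: (n.+1%:R^-1) nd n0 p1 p2 q1 q2 => r nd n0 p1 p2 q1 q2.
  rewrite asboolT.
    by split; rewrite /= in_itv/=; apply/andP; split; lra.
  move=> v [] /=; rewrite !in_itv/= => /andP[v1 v2] /andP[v3 v4].
  by apply: dP; rewrite ltr_norml; apply/andP; split; lra.
apply: bigcupT_measurable_rat => p; apply: bigcupT_measurable_rat => q.
by apply: bigcupT_measurable => n; case: ifP.
Qed.

Lemma plane_continuous_measurable (U : set (R * R)) (g : R * R -> R) : plane_open U ->
  (forall w, U w -> forall e : R, 0 < e -> exists2 d : R, 0 < d &
     forall v : R * R, `|v.1 - w.1| < d -> `|v.2 - w.2| < d -> `|g v - g w| < e) ->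
  measurable_fun U g.
Proof.
move=> oU gc mU; apply: (measurability _ (RGenOInfty.measurableE R)) => //.
move=> _ [_ [x ->] <-]; apply: plane_open_measurable => w [Uw].
rewrite /= in_itv/= andbT => xg.
have [d1 d10 d1P] := oU w Uw.
have [d2 d20 d2P] := gc w Uw (g w - x) ltac:(by rewrite subr_gt0).
exists (Num.min d1 d2) => [|v]; first by rewrite lt_min d10.
rewrite !lt_min => /andP[a1 a2] /andP[b1 b2]; split; first exact: d1P.
have := d2P v a2 b2; rewrite /= in_itv/= andbT ltr_norml => /andP[].
by lra.
Qed.

Definition quat_measurable (U : set (R * R)) (g : R * R -> H) :=
  [/\ measurable_fun U (fun w => qr (g w)), measurable_fun U (fun w => qi (g w)),
      measurable_fun U (fun w => qj (g w)) & measurable_fun U (fun w => qk (g w))].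

Lemma quat_measurableD U g1 g2 : quat_measurable U g1 -> quat_measurable U g2 ->
  quat_measurable U (fun w => g1 w + g2 w).
Proof. by move=> [? ? ? ?] [? ? ? ?]; split; exact: measurable_funD. Qed.

Lemma quat_measurableM U g1 g2 : quat_measurable U g1 -> quat_measurable U g2 ->
  quat_measurable U (fun w => g1 w * g2 w).
Proof.
move=> [? ? ? ?] [? ? ? ?]; split => /=;
  do ?[apply: measurable_funB | apply: measurable_funD | apply: measurable_funM]; by [].
Qed.

Lemma quat_measurableZ U (a : R) g : quat_measurable U g ->
  quat_measurable U (fun w => a *: g w).
Proof. by move=> [? ? ? ?]; split; apply: measurable_funM => //; exact: measurable_cst. Qed.

Lemma quat_measurable_sqr_norm U g : quat_measurable U g ->
  measurable_fun U (fun w => `|g w| ^+ 2).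
Proof.
move=> [? ? ? ?]; under eq_fun do rewrite quat_sqr_norm /quat_sqnorm.
by do ?[apply: measurable_funD]; exact: measurable_funX.
Qed.

Lemma quat_continuous_measurable (U : set (R * R)) (g : R * R -> H) : plane_open U ->
  (forall w, U w -> forall e : R, 0 < e -> exists2 d : R, 0 < d &
     forall v : R * R, `|v.1 - w.1| < d -> `|v.2 - w.2| < d -> `|g v - g w| < e) ->
  quat_measurable U g.
Proof.
move=> oU gc; split; apply: plane_continuous_measurable => // w Uw e e0;
  have [d d0 dP] := gc w Uw e e0; exists d => // v v1 v2;
  apply: le_lt_trans (dP v v1 v2).
- exact: (quat_qr_le (g v - g w)).
- exact: (quat_qi_le (g v - g w)).
- exact: (quat_qj_le (g v - g w)).
- exact: (quat_qk_le (g v - g w)).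
Qed.

Lemma quat_measurable_cvg U (g : nat -> R * R -> H) (h : R * R -> H) :
  (forall n, quat_measurable U (g n)) ->
  (forall w, U w -> forall e : R, 0 < e -> exists N, forall n, (N <= n)%N -> `|h w - g n w| < e) ->
  quat_measurable U h.
Proof.
move=> mg gh.
have key (c : H -> R) : (forall p q, c (p - q) = c p - c q) -> (forall q, `|c q| <= `|q|) ->
    (forall n, measurable_fun U (fun w => c (g n w))) -> measurable_fun U (fun w => c (h w)).
  move=> cB cle mc; apply: (@measurable_fun_cvg _ _ _ _ (fun n w => c (g n w))) => // w Uw.
  apply/cvgrPdist_lt => e /(gh w Uw)[N NP]; near=> n.
  rewrite -cB (le_lt_trans (cle _))// NP//; near: n; exact: nbhs_infty_ge.
split.
- by apply: (key (@qr R)) => // [q|n]; [exact: quat_qr_le|case: (mg n)].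
- by apply: (key (@qi R)) => // [q|n]; [exact: quat_qi_le|case: (mg n)].
- by apply: (key (@qj R)) => // [q|n]; [exact: quat_qj_le|case: (mg n)].
- by apply: (key (@qk R)) => // [q|n]; [exact: quat_qk_le|case: (mg n)].
Unshelve. all: by end_near. Qed.

End PlaneMeasurability.

(** * The fractional derivative of a slice regular function *)

Section FractionalDerivative.
Variable R : realType.
Local Open Scope complex_scope.
Local Notation C := (complex R).
Local Notation H := (quat R).
Local Notation Re := (@complex.Re R).
Local Notation Im := (@complex.Im R).
Variables (I : H) (IS : imag_sphere R I).
Implicit Types (z w : C) (p q D : H) (g : C -> H) (f : Efun R) (v : R * R).
Local Notation slice := (slice I).

Definition pt v : C := v.1 +i* v.2.

Definition slice_region : set (R * R) := [set v | Eslice I (slice_pt I v)].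

Lemma slice_regionP v : slice_region v <-> slitdisc (pt v).
Proof.
split=> [[vE _]|vd]; first exact/(Edom_slice IS).
exact: (Eslice_slice IS vd).
Qed.

Lemma normc_pt v v' (d : R) : `|v'.1 - v.1| < d / 2 -> `|v'.2 - v.2| < d / 2 ->
  normc (pt v' - pt v) < d.
Proof. by move=> h1 h2; apply: (le_lt_trans (normc_le _)); rewrite ReB ImB /=; lra. Qed.

Lemma slice_region_open : plane_open slice_region.
Proof.
move=> v /slice_regionP /slitdisc_open[d d0 dP]; exists (d / 2) => [|v' h1 h2].
  by rewrite divr_gt0.
by apply/slice_regionP/dP/normc_pt.
Qed.

Lemma sderiv_lin g1 g2 z D1 D2 (c : H) : is_sderiv I g1 z D1 -> is_sderiv I g2 z D2 ->
  is_sderiv I (fun w => g1 w * c + g2 w) z (D1 * c + D2).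
Proof.
move=> d1 d2 e e0; have c1 : 0 < `|c| + 1 by rewrite ltr_wpDl.
have [r1 r10 r1P] := d1 (e / 2 / (`|c| + 1)) ltac:(by rewrite !divr_gt0).
have [r2 r20 r2P] := d2 (e / 2) ltac:(by rewrite divr_gt0).
exists (Num.min r1 r2) => [|w]; first by rewrite lt_min r10.
rewrite lt_min => /andP[/r1P h1 /r2P h2].
rewrite (_ : _ - _ - _ = (g1 w - g1 z - slice (w - z) * D1) * c
                         + (g2 w - g2 z - slice (w - z) * D2)); last first.
  have sum6 (a b a' b' x y : H) : a + b - (a' + b') - (x + y) = (a - a' - x) + (b - b' - y).
    by rewrite !opprD (addrACA a) (addrACA (a - a')).
  by rewrite mulrDr sum6 mulrA -!mulrBl.
apply: (le_trans (ler_normD _ _)); rewrite quat_normM.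
rewrite [leRHS](_ : _ = e / 2 * normc (w - z) + e / 2 * normc (w - z)); last by field.
rewrite lerD//; apply: (@le_trans _ _ (e / 2 / (`|c| + 1) * normc (w - z) * `|c|)).
  by rewrite ler_wpM2r.
rewrite [leLHS]mulrAC ler_wpM2r ?normc_ge0// -[leLHS]mulrA ler_piMr ?divr_ge0 ?(ltW e0)//.
by rewrite ler_pdivrMl// mulr1 lerDl.
Qed.

Lemma slice_continuous_measurable (U : set (R * R)) (F : C -> H) : plane_open U ->
  (forall v, U v -> forall e : R, 0 < e -> exists2 d : R, 0 < d &
    forall w, normc (w - pt v) < d -> `|F w - F (pt v)| < e) ->
  quat_measurable U (fun v => F (pt v)).
Proof.
move=> oU Fc; apply: quat_continuous_measurable => // v Uv e e0.
have [d d0 dP] := Fc v Uv e e0; exists (d / 2) => [|v' h1 h2]; first by rewrite divr_gt0.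
by apply/dP/normc_pt.
Qed.

Variables (alpha : R) (k : nat).
Hypotheses (alpha_gt0 : 0 < alpha) (k_ge1 : (1 <= k)%N).
Hypothesis ek_neq0 : forall q : H, Edom R q -> trunc_exp k.-1 (qpow alpha q) <> 0.

Lemma ek_pow'_neq0 z : slitdisc z -> ek_pow' alpha k z != 0.
Proof.
move=> zd; have zs : slitplane z by case: zd.
have z0 := slitplane_neq0 zs.
have p0 := cpow_neq0 alpha z0.
rewrite /ek_pow'; apply: mulf_neq0; last (apply: mulf_neq0; last by rewrite invr_eq0);
  last apply: mulf_neq0 => //.
- apply/eqP => E; apply: (@ek_neq0 (slice z)); first exact/(Edom_slice IS).
  by rewrite qpow_slice// trunc_exp_slice// E slice0.
- by rewrite (inj_eq (@complexI R)) gt_eqF.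
Qed.

Lemma ek_pow'_differentiable z : slitdisc z -> cdifferentiable (ek_pow' alpha k) z.
Proof.
move=> zd; have zs : slitplane z by case: zd.
have P : cdifferentiable (cpow alpha) z by eexists; exact: cderiv_cpow.
apply: cdifferentiableM.
  case: (k.-1) => [|j].
    exists 0; apply: cderiv_near (cderiv_cst 1 z); exists 1 => // w _.
    by rewrite /ctrunc_exp big_ord1 expr0 mulr1 invr1.
  by eexists; apply: cderiv_ctrunc_exp; exact: cderiv_cpow.
apply: cdifferentiableM; last by eexists; apply: cderiv_inv; exact: slitplane_neq0.
by apply: cdifferentiableM => //; eexists; exact: cderiv_cst.
Qed.

Lemma ek_pow'V_measurable : quat_measurable slice_region (fun v => (slice (ek_pow' alpha k (pt v)))^-1).
Proof.
apply: (@slice_continuous_measurable _ (fun z => (slice (ek_pow' alpha k z))^-1)).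
  exact: slice_region_open.
move=> v /slice_regionP vd e e0.
have [D ED] := ek_pow'_differentiable vd.
have VD : cdifferentiable (fun z => (ek_pow' alpha k z)^-1) (pt v).
  by eexists; apply: (cderiv_comp ED); apply: cderiv_inv; exact: ek_pow'_neq0.
have [d d0 dP] := cdifferentiable_cvg VD e0.
by exists d => // w /dP; rewrite -!sliceV// -sliceB// slice_norm.
Qed.

Definition sder f z : H := 'd (Eext f) (slice z) 1.

Lemma sderP f z : slice_regular f -> slitdisc z ->
  is_sderiv I (fun w => Eext f (slice w)) z (sder f z).
Proof. exact: slice_regular_sderiv. Qed.

Lemma Eext_measurable f : slice_regular f ->
  quat_measurable setT (fun v => Eext f (slice (pt v))).
Proof.
move=> fr.
have mA := plane_open_measurable slice_region_open.
have [m1 m2 m3 m4] : quat_measurable slice_region (fun v => Eext f (slice (pt v))).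
  apply: (@slice_continuous_measurable _ (fun z => Eext f (slice z))).
    exact: slice_region_open.
  by move=> v /slice_regionP vd e e0; exact: (sderiv_cvg IS (sderP fr vd)).
have out v : ~ slice_region v -> Eext f (slice (pt v)) = 0.
  move=> vA; have [[x E _]|[]//] := EextP f (slice (pt v)); case: vA.
  by apply/slice_regionP/(Edom_slice IS); rewrite E; exact: set_valP.
have key (c : H -> R) : c 0 = 0 -> measurable_fun slice_region (fun v => c (Eext f (slice (pt v)))) ->
    measurable_fun setT (fun v => c (Eext f (slice (pt v)))).
  move=> c0 /(measurable_restrictT _ mA); congr (measurable_fun _ _).
  by apply/funext => v; rewrite patchE; case: ifPn => //; rewrite notin_setE => /out ->.
by split; [apply: (key (@qr R))|apply: (key (@qi R))|apply: (key (@qj R))|apply: (key (@qk R))].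
Qed.

Lemma quat_measurable_sub (U : set (R * R)) (F : R * R -> H) :
  quat_measurable setT F -> quat_measurable U F.
Proof. by move=> [? ? ? ?]; split; exact: measurable_funTS. Qed.

(** The slice derivative is the limit of the difference quotients in the real direction with
    steps 1 / (n + 1). *)
Lemma sder_measurable f : slice_regular f ->
  quat_measurable slice_region (fun v => sder f (pt v)).
Proof.
move=> fr.
pose F v := Eext f (slice (pt v)).
have mF := Eext_measurable fr.
pose h (n : nat) : R := n.+1%:R^-1.
have h0 n : 0 < h n by rewrite invr_gt0.
apply: (@quat_measurable_cvg _ _ (fun n v => (h n)^-1 *: (F (v.1 + h n, v.2) + (-1) *: F v))).
  move=> n; apply: quat_measurable_sub; apply/quat_measurableZ/quat_measurableD.
    have ms : measurable_fun setT (fun v : R * R => (v.1 + h n, v.2)).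
      apply: measurable_fun_pair; last exact: measurable_snd.
      by apply: measurable_funD; [exact: measurable_fst|exact: measurable_cst].
    by case: mF => m1 m2 m3 m4; split; [exact: (measurableT_comp m1 ms)|
      exact: (measurableT_comp m2 ms)|exact: (measurableT_comp m3 ms)|exact: (measurableT_comp m4 ms)].
  exact: quat_measurableZ.
move=> v /slice_regionP vd e e0.
have e20 : 0 < e / 2 by rewrite divr_gt0.
have [d d0 dP] := sderP fr vd e20.
pose N := Num.bound d^-1.
exists N => n Nn.
have hn : h n < d.
  rewrite /h invf_plt ?posrE//.
  have : d^-1 < N%:R by apply: archi_boundP; rewrite invr_ge0 ltW.
  by move=> /lt_le_trans; apply; rewrite ler_nat ltnW.
have E : pt (v.1 + h n, v.2) = pt v + (h n)%:C.
  by apply/eqP; rewrite eq_complex /=; apply/andP; split; apply/eqP; ring.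
have nh : normc (pt v + (h n)%:C - pt v) = h n by rewrite addrC addKr normc_real gtr0_norm.
have := dP (pt v + (h n)%:C); rewrite nh => /(_ hn) L.
rewrite /F E scaleN1r.
rewrite (_ : _ - _ = - ((h n)^-1 *: (Eext f (slice (pt v + (h n)%:C)) - Eext f (slice (pt v))
   - slice (pt v + (h n)%:C - pt v) * sder f (pt v)))); last first.
  have -> : pt v + (h n)%:C - pt v = (h n)%:C by rewrite addrC addKr.
  rewrite slice_real// -[(h n)%:A * _]scalerAl mul1r [in RHS]scalerBr scalerA.
  by rewrite mulVf ?scale1r ?opprB// gt_eqF.
rewrite normrN normrZ gtr0_norm ?invr_gt0// ltr_pdivrMl//.
by apply: (le_lt_trans L); rewrite mulrC ltr_pM2l//; lra.
Qed.

Variable sigma : R.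

Lemma frac_derivE f v : slice_regular f -> slice_region v ->
  frac_deriv sigma alpha k I f (slice_pt I v) =
  (1 - sigma) *: Eext f (slice (pt v)) + sigma *: ((slice (ek_pow' alpha k (pt v)))^-1 * sder f (pt v)).
Proof.
move=> fr /slice_regionP vd.
exact: (frac_deriv_slice IS sigma vd k_ge1 (sderP fr vd) (ek_pow'_neq0 vd)).
Qed.

Lemma frac_deriv_lin (c : H^c) f1 f2 v : slice_regular f1 -> slice_regular f2 -> slice_region v ->
  frac_deriv sigma alpha k I (c *: f1 + f2) (slice_pt I v) =
  frac_deriv sigma alpha k I f1 (slice_pt I v) * (c : H)
  + frac_deriv sigma alpha k I f2 (slice_pt I v).
Proof.
move=> r1 r2 vA; have vd := (slice_regionP v).1 vA.
have D12 : is_sderiv I (fun w => Eext (c *: f1 + f2) (slice w)) (pt v)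
    (sder f1 (pt v) * (c : H) + sder f2 (pt v)).
  have -> : (fun w => Eext (c *: f1 + f2) (slice w)) =
      (fun w => Eext f1 (slice w) * (c : H) + Eext f2 (slice w)).
    by apply/funext => w; exact: Eext_lin.
  exact: (sderiv_lin (c : H) (sderP r1 vd) (sderP r2 vd)).
rewrite (frac_derivE r1 vA) (frac_derivE r2 vA).
apply: (etrans (frac_deriv_slice IS sigma vd k_ge1 D12 (ek_pow'_neq0 vd))).
rewrite Eext_lin; move: (Eext f1 _) (Eext f2 _) (sder f1 _) (sder f2 _) (_^-1).
move=> a1 a2 b1 b2 e; rewrite mulrDr !scalerDr mulrDl -!scalerAl mulrA.
by rewrite addrACA.
Qed.

Lemma frac_deriv_measurable f : slice_regular f ->
  quat_measurable slice_region (fun v => frac_deriv sigma alpha k I f (slice_pt I v)).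
Proof.
move=> fr.
have : quat_measurable slice_region (fun v => (1 - sigma) *: Eext f (slice (pt v))
    + sigma *: ((slice (ek_pow' alpha k (pt v)))^-1 * sder f (pt v))).
  apply: quat_measurableD; apply: quat_measurableZ.
    exact/quat_measurable_sub/Eext_measurable.
  by apply: quat_measurableM; [exact: ek_pow'V_measurable|exact: sder_measurable].
have E v : v \in slice_region -> (1 - sigma) *: Eext f (slice (pt v))
    + sigma *: ((slice (ek_pow' alpha k (pt v)))^-1 * sder f (pt v)) =
    frac_deriv sigma alpha k I f (slice_pt I v) by rewrite inE => /(frac_derivE fr) ->.
move=> [m1 m2 m3 m4]; split.
- by apply: eq_measurable_fun m1 => v /E/(congr1 (@qr R)).
- by apply: eq_measurable_fun m2 => v /E/(congr1 (@qi R)).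
- by apply: eq_measurable_fun m3 => v /E/(congr1 (@qj R)).
- by apply: eq_measurable_fun m4 => v /E/(congr1 (@qk R)).
Qed.

End FractionalDerivative.

(** * The norm axioms other than definiteness *)

(** Formally t = sqrt G / sqrt F turns the right hand side into (sqrt F + sqrt G)^2. *)
Lemma sqrt_triangle (R : realType) (S F G : R) : 0 <= F -> 0 <= G ->
  (forall t : R, 0 < t -> S <= (1 + t) * F + (1 + t^-1) * G) ->
  Num.sqrt S <= Num.sqrt F + Num.sqrt G.
Proof.
move=> F0 G0 SFG.
suff main (x y : R) : 0 <= x -> 0 <= y -> x ^+ 2 = F -> y ^+ 2 = G -> Num.sqrt S <= x + y.
  by apply: main; rewrite ?sqrtr_ge0 ?sqr_sqrtr.
move=> x0 y0 xF yG.
apply/ler_addgt0Pl => e e0.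
pose d := e / 2; have d0 : 0 < d by rewrite divr_gt0.
have xd : 0 < x + d by lra.
have yd : 0 < y + d by lra.
have t0 : 0 < (y + d) / (x + d) by rewrite divr_gt0.
have := SFG _ t0; rewrite -xF -yG => L.
have L2 : S <= (x + d + (y + d)) ^+ 2.
  apply: (le_trans L).
  have -> : (x + d + (y + d)) ^+ 2 = (1 + (y + d) / (x + d)) * (x + d) ^+ 2
     + (1 + ((y + d) / (x + d))^-1) * (y + d) ^+ 2.
    by field; rewrite !gt_eqF.
  have t1 : 0 <= 1 + (y + d) / (x + d) by lra.
  have ti1 : 0 <= 1 + ((y + d) / (x + d))^-1 by rewrite addr_ge0// invr_ge0 ltW.
  have mono (c a : R) : 0 <= c -> 0 <= a -> c * a ^+ 2 <= c * (a + d) ^+ 2.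
    by move=> c0 a0; rewrite ler_wpM2l// ler_pXn2r ?nnegrE//; lra.
  by apply: lerD; exact: mono.
have := ler_wsqrtr L2; rewrite sqrtr_sqr ger0_norm; last lra.
by rewrite /d; lra.
Qed.

Section DirichletNorm.
Variable R : realType.
Local Notation H := (quat R).
Local Notation mu2 := ((@lebesgue_measure R) \x (@lebesgue_measure R))%E.
Variables (I : H) (IS : imag_sphere R I) (sigma alpha : R) (k : nat).
Hypotheses (alpha_gt0 : 0 < alpha) (k_ge1 : (1 <= k)%N).
Hypothesis ek_neq0 : forall q : H, Edom R q -> trunc_exp k.-1 (qpow alpha q) <> 0.
Implicit Types (f g : Efun R) (c : H^c).

Local Notation frac f v := (frac_deriv sigma alpha k I f (slice_pt I v)).
Local Notation sqn := (Dsqnorm sigma alpha k I).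
Local Notation A := (slice_region I).

Definition energy f : \bar R := (\int[mu2]_(v in A) (`|frac f v| ^+ 2)%:E)%E.

Lemma DsqnormE f : sqn f = ((alpha * `|Eext f (2^-1)%:A| ^+ 2)%:E + energy f)%E.
Proof. by []. Qed.

Lemma energy_ge0 f : (0 <= energy f)%E.
Proof. by apply: integral_ge0 => v _; rewrite lee_fin sqr_ge0. Qed.

Lemma point_ge0 f : 0 <= alpha * `|Eext f (2^-1)%:A| ^+ 2.
Proof. by rewrite mulr_ge0 ?sqr_ge0 ?ltW. Qed.

Lemma Dsqnorm_ge0 f : (0 <= sqn f)%E.
Proof. by rewrite DsqnormE adde_ge0 ?energy_ge0// lee_fin point_ge0. Qed.

Lemma measurable_region : measurable A.
Proof. exact: plane_open_measurable (slice_region_open IS). Qed.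

Lemma density_measurable f : slice_regular f ->
  measurable_fun A (fun v => (`|frac f v| ^+ 2)%:E).
Proof.
move=> fr; apply/measurable_EFinP.
exact: quat_measurable_sqr_norm (frac_deriv_measurable IS alpha_gt0 k_ge1 ek_neq0 sigma fr).
Qed.

Lemma frac0 v : A v -> frac (0 : Efun R) v = 0.
Proof.
move=> vA; have r0 := @slice_regular0 R.
have := frac_deriv_lin IS alpha_gt0 k_ge1 ek_neq0 sigma (1 : H^c) r0 r0 vA.
rewrite scaler0 addr0 mulr1 -[LHS]addr0 => /addrI.
by move=> <-.
Qed.

Lemma Dsqnorm0 : sqn (0 : Efun R) = 0%E.
Proof.
rewrite DsqnormE Eext0 normr0 expr0n mulr0 add0e /energy.
rewrite (@eq_integral _ _ _ _ _ (cst 0%E)); first exact: integral0.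
by move=> v; rewrite inE => /frac0 ->; rewrite normr0 expr0n.
Qed.

Lemma Dsqnorm_scale c f : slice_regular f -> sqn (c *: f) = ((`|c : H| ^+ 2)%:E * sqn f)%E.
Proof.
move=> fr; have r0 := @slice_regular0 R.
have fracZ v : A v -> (`|frac (c *: f) v| ^+ 2)%:E = ((`|c : H| ^+ 2)%:E * (`|frac f v| ^+ 2)%:E)%E.
  move=> vA; have := frac_deriv_lin IS alpha_gt0 k_ge1 ek_neq0 sigma c fr r0 vA.
  by rewrite (frac0 vA) !addr0 => ->; rewrite quat_normM exprMn mulrC.
rewrite !DsqnormE ge0_muleDr ?energy_ge0 ?lee_fin ?point_ge0//; congr (_ + _)%E.
  have := Eext_lin c f 0 (2^-1)%:A; rewrite addr0 Eext0 addr0 => ->.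
  by rewrite quat_normM exprMn -EFinM; congr EFin; ring.
transitivity (\int[mu2]_(v in A) ((`|c : H| ^+ 2)%:E * (`|frac f v| ^+ 2)%:E))%E.
  by apply: eq_integral => v; rewrite inE; exact: fracZ.
apply: ge0_integralZl => //; first exact: measurable_region.
exact: density_measurable.
Qed.

Lemma Dsqnorm_add f g (t : R) : slice_regular f -> slice_regular g -> 0 < t ->
  (sqn (f + g)%R <= (1 + t)%:E * sqn f + (1 + t^-1)%:E * sqn g)%E.
Proof.
move=> fr gr t0; have ti0 : 0 < t^-1 by rewrite invr_gt0.
have t1 : 0 <= 1 + t by rewrite addr_ge0// ltW.
have ti1 : 0 <= 1 + t^-1 by rewrite addr_ge0// ltW.
have fracD v : A v -> frac (f + g)%R v = frac f v + frac g v.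
  move=> vA; have := frac_deriv_lin IS alpha_gt0 k_ge1 ek_neq0 sigma (1 : H^c) fr gr vA.
  by rewrite scale1r mulr1.
have fgr : slice_regular (f + g) by rewrite -[f]scale1r; exact: slice_regular_lin.
have distr (x : R) h : (x%:E * sqn h = x%:E * (alpha * `|Eext h (2^-1)%:A| ^+ 2)%:E + x%:E * energy h)%E.
  by apply: ge0_muleDr; [rewrite lee_fin point_ge0|exact: energy_ge0].
rewrite !distr DsqnormE addeACA; apply: leeD.
  rewrite -!EFinM -EFinD lee_fin.
  have := Eext_lin (1 : H^c) f g (2^-1)%:A; rewrite scale1r mulr1 => ->.
  rewrite [leRHS](_ : _ = alpha * ((1 + t) * `|Eext f (2^-1)%:A| ^+ 2 +
    (1 + t^-1) * `|Eext g (2^-1)%:A| ^+ 2)); last by ring.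
  by rewrite ler_wpM2l ?(ltW alpha_gt0)// sqr_norm_add_le.
have mf := density_measurable fr; have mg := density_measurable gr.
have mA := measurable_region.
have sq0 h v : A v -> (0 <= (`|frac h v| ^+ 2)%:E)%E by move=> _; rewrite lee_fin sqr_ge0.
rewrite /energy -!ge0_integralZl//; try exact: sq0.
rewrite -ge0_integralD//; try (by move=> v vA; rewrite mule_ge0// ?sq0);
  try exact: measurable_funeM.
apply: ge0_le_integral => //.
- exact: density_measurable.
- by apply: emeasurable_funD; exact: measurable_funeM.
- by move=> v vA; rewrite -!EFinM -EFinD lee_fin fracD// sqr_norm_add_le.
Qed.

Lemma Dspace_fin_num f : (sqn f < +oo)%E -> sqn f = (fine (sqn f))%:E.
Proof. by move=> foo; rewrite fineK// ge0_fin_numE// Dsqnorm_ge0. Qed.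

Lemma fine_ge0_sqn f : 0 <= fine (sqn f).
Proof. exact/fine_ge0/Dsqnorm_ge0. Qed.

Lemma Dspace_closed c f g : Dspace sigma alpha k I f -> Dspace sigma alpha k I g ->
  Dspace sigma alpha k I (c *: f + g).
Proof.
move=> [fr foo] [gr goo]; split; first exact: slice_regular_lin.
have cr : slice_regular (c *: f).
  by rewrite -[c *: f]addr0; apply: slice_regular_lin => //; exact: slice_regular0.
apply: (le_lt_trans (Dsqnorm_add cr gr ltr01)).
rewrite Dsqnorm_scale// (Dspace_fin_num foo) (Dspace_fin_num goo).
by rewrite -!EFinM -EFinD ltry.
Qed.

Lemma Dnorm_scale c f : Dspace sigma alpha k I f ->
  Dnorm sigma alpha k I (c *: f) = Dnorm sigma alpha k I f * `|c : H|.
Proof.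
move=> [fr foo]; rewrite /Dnorm Dsqnorm_scale// (Dspace_fin_num foo) -EFinM /=.
by rewrite sqrtrM ?sqr_ge0// sqrtr_sqr normr_id mulrC.
Qed.

Lemma Dnorm_triangle f g : Dspace sigma alpha k I f -> Dspace sigma alpha k I g ->
  Dnorm sigma alpha k I (f + g) <= Dnorm sigma alpha k I f + Dnorm sigma alpha k I g.
Proof.
move=> fD gD; have [fr foo] := fD; have [gr goo] := gD.
have [_ fgoo] : Dspace sigma alpha k I (f + g) by rewrite -[f]scale1r; exact: Dspace_closed.
apply: (sqrt_triangle (fine_ge0_sqn f) (fine_ge0_sqn g)) => t t0.
have := Dsqnorm_add fr gr t0.
by rewrite (Dspace_fin_num foo) (Dspace_fin_num goo) (Dspace_fin_num fgoo) -!EFinM -EFinD lee_fin.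
Qed.

End DirichletNorm.

(** * Differential inequalities holding almost everywhere *)

Section AeMonotone.
Variable R : realType.
Local Notation mu := (@lebesgue_measure R).

Lemma derive_local_le (f : R -> R) (x D e : R) : is_derive x 1 f D -> 0 < e ->
  exists2 d : R, 0 < d & forall s t, x - d < s -> s <= x -> x <= t -> t < x + d ->
    f t - f s <= (D + e) * (t - s).
Proof.
move=> fD e0; have [d d0 dP] := derive_approx fD e0.
exists d => // s t sd sx xt td.
have := dP t ltac:(by rewrite ger0_norm; lra); have := dP s ltac:(by rewrite ler0_norm; lra).
rewrite [`|t - x|]ger0_norm ?subr_ge0// [`|s - x|]ler0_norm ?subr_le0//.
by rewrite !ler_norml => /andP[? ?] /andP[? ?]; lra.
Qed.

(** Let U m be open sets containing the exceptional set N, so small that the increasing function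
    W x = sum over m of (m + 1) mu (U m meet [a, x]) is at most e. Around a point of N the
    function W grows with slope at least m + 1, where m can be chosen larger than the
    derivative of f; elsewhere the slope e is enough. So f x - f a - e (x - a) <= W x propagates from a
    to b. *)
Lemma ae_derive_le0 (f df : R -> R) (a b : R) : a <= b ->
  (forall x, a <= x <= b -> is_derive x 1 f (df x)) ->
  mu.-negligible [set x | a <= x <= b /\ 0 < df x] -> f b <= f a.
Proof.
move=> ab fd; set N := [set x | _]; rewrite negligible_outer_measure => N0.
suff H e : 0 < e -> f b - f a <= e * (b - a + 1).
  rewrite -subr_le0; apply/ler_addgt0Pl => e e0; rewrite addr0.
  have b1 : 0 < b - a + 1 by lra.
  by have := H (e / (b - a + 1)) ltac:(by rewrite divr_gt0); rewrite divfK ?gt_eqF.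
move=> e0.
pose em (m : nat) := (e / (2 ^ m.+1)%:R) / m.+1%:R.
have em0 m : 0 < em m by rewrite !divr_gt0// ltr0n ?expn_gt0.
have /choice[U UP] : forall m, exists U, [/\ open U, N `<=` U & (mu U <= (em m)%:E)%E].
  by move=> m; have := outer_measure_open_le N (em0 m); rewrite N0 add0e.
have mU m : measurable (U m) by apply: measurable_realfun.open_measurable; case: (UP m).
have lemu (A B : set R) : measurable A -> measurable B -> A `<=` B -> (mu A <= mu B)%E.
  by move=> mA mB AB; apply: le_measure; rewrite ?inE.
have mUI m x : measurable (U m `&` `[a, x]) by exact: measurableI.
pose w x (m : nat) : \bar R := (m.+1%:R%:E * mu (U m `&` `[a, x]))%E.
have w0 x m : (0 <= w x m)%E by rewrite mule_ge0.
pose W x := (\sum_(m <oo) w x m)%E.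
have W0 x : (0 <= W x)%E by apply: nneseries_ge0.
have We : (W b <= e%:E)%E.
  apply: (@le_trans _ _ (\sum_(m <oo) (e / (2 ^ m.+1)%:R)%:E)%E).
    apply: lee_nneseries => // m _; rewrite /w.
    apply: (@le_trans _ _ (m.+1%:R%:E * (em m)%:E)%E).
      apply: lee_pmul => //; have [_ _] := UP m; apply: le_trans.
      by apply: lemu => // x [].
    by rewrite -EFinM /em mulrC divfK.
  by have := epsilon_trick0 xpredT (ltW e0).
have Wmono s t : s <= t -> (W s <= W t)%E.
  move=> st; apply: lee_nneseries => // m _; apply: lee_pmul => //.
  apply: lemu => //.
  by apply: setIS; apply: subset_itvl; rewrite bnd_simp.
have Wgrow m s t : a <= s -> s <= t -> `]s, t]%classic `<=` U m ->
    (W s + (m.+1%:R * (t - s))%:E <= W t)%E.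
  move=> as_ st stU.
  rewrite /W !(@nneseriesD1 _ _ m xpredT)// addeAC leeD//; last first.
    apply: lee_nneseries => // j _; apply: lee_pmul => //.
    apply: lemu => //.
    by apply: setIS; apply: subset_itvl; rewrite bnd_simp.
  have E : (mu `]s, t] = (t - s)%:E)%E.
    rewrite lebesgue_measure_itv/= lte_fin; case: ltP => [//|ts].
    by rewrite (_ : t = s) ?subrr//; apply/eqP; rewrite eq_le ts st.
  rewrite /w EFinM -E -ge0_muleDr//; apply: lee_pmul => //.
    exact: adde_ge0.
  rewrite -measureU//; last 2 first.
  - exact: mUI.
  - apply/seteqP; split => // x [[_]]; rewrite /= !in_itv/= => /andP[_ xs] /andP[sx _].
    by have := lt_le_trans sx xs; rewrite ltxx.
  apply: lemu; [by apply: measurableU => //; exact: mUI|exact: mUI|].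
  move=> x [[Ux]|] /=; rewrite !in_itv/=; last first.
    by move=> xst; split; [apply: stU; rewrite /= in_itv|have /andP[? ?] := xst; apply/andP; split; lra].
  by move=> /andP[ax xs]; split => //; rewrite ax (le_trans xs).
pose Q x := ((f x - f a - e * (x - a))%:E <= W x)%E.
have Qa : Q a by rewrite /Q !subrr mulr0 subrr W0.
have local c : a <= c <= b -> exists2 d : R, 0 < d & forall s t,
    a <= s -> c - d < s -> s <= c -> c <= t -> t <= b -> t < c + d -> Q s -> Q t.
  move=> cab; have [d d0 dP] := derive_local_le (fd c cab) e0.
  have [dc|dc] := leP (df c) 0.
    exists d => // s t as_ ds sc ct tb td Qs.
    have := Wmono s t (le_trans sc ct); apply: le_trans; apply: le_trans Qs.
    have := dP s t ds sc ct td; rewrite lee_fin.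
    have : df c * (t - s) <= 0 by rewrite mulr_le0_ge0//; lra.
    by rewrite mulrDl; lra.
  pose m := Num.bound (df c).
  have dm : df c < m%:R by apply: archi_boundP; exact: ltW.
  have [oU NU _] := UP m.
  have Uc : U m c by apply: NU; split.
  have [d' /= d'0 d'P] : nbhs c (U m) by apply: open_nbhs_nbhs.
  exists (Num.min d d') => [|s t as_]; first by rewrite lt_min d0.
  move=> ds sc ct tb td Qs.
  have d1 : Num.min d d' <= d by rewrite ge_min lexx.
  have d2 : Num.min d d' <= d' by rewrite ge_min lexx orbT.
  have stU : `]s, t]%classic `<=` U m.
    move=> x; rewrite /= in_itv/= => /andP[sx xt]; apply: d'P.
    by rewrite /ball_/= ltr_norml; apply/andP; split; lra.
  have := Wgrow _ _ _ as_ (le_trans sc ct) stU.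
  apply: le_trans; rewrite EFinD; apply: le_trans (leeD Qs (lexx _)).
  rewrite -EFinD lee_fin.
  have := dP s t ltac:(lra) sc ct ltac:(lra).
  have : df c * (t - s) <= m.+1%:R * (t - s).
    by rewrite ler_wpM2r//; [lra|rewrite -natr1; lra].
  by rewrite mulrDl; lra.
pose S := [set x | a <= x <= b /\ Q x].
have Sa : S a by split=> //; rewrite lexx.
have Sub : has_ubound S by exists b => x [/andP[]].
pose c := sup S.
have ca : a <= c by apply: ub_le_sup.
have cb : c <= b by apply: ge_sup; [exists a|move=> x [/andP[]]].
have [d d0 dP] := local c ltac:(by rewrite ca cb).
have [s [/andP[as_ sb] Qs] cs] : exists2 s, S s & c - d < s.
  by apply: sup_adherent => //; split=> //; exists a.
have sc : s <= c by apply: ub_le_sup => //; split => //; rewrite as_ sb.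
suff Qb : Q b.
  have : ((f b - f a - e * (b - a))%:E <= e%:E)%E by exact: le_trans Qb We.
  by rewrite lee_fin; lra.
have [cbd|bcd] := leP (c + d / 2) b; last by apply: (dP s b) => //; lra.
have : S (c + d / 2).
  by split; [apply/andP; split; lra|apply: (dP s) => //; lra].
by move=> /(ub_le_sup Sub); rewrite -/c; lra.
Qed.

End AeMonotone.

Section NullSections.
Variable R : realType.
Local Notation mu := (@lebesgue_measure R).

(** By Fubini almost every horizontal section of a null set is null, and the interval ]0, e[
    has positive measure. *)
Lemma null_sections (N : set (R * R)) (e : R) : (mu \x mu)%E.-negligible N -> 0 < e ->
  exists2 y, 0 < y < e & mu.-negligible (ysection N y).
Proof.
move=> [M [mM M0 NM]] e0.
have M2 : (\int[mu]_(y in setT) `|(mu \o ysection M) y|)%E = 0%E.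
  rewrite -M0 (@product_measure_unique _ _ _ _ _ mu mu (mu \x^ mu)%E) //.
    by apply: eq_integral => y _; rewrite gee0_abs.
  by move=> A B mA mB; exact: product_measure2E.
have [/(_ M2)[P [mP P0 PS]] _] :=
  ae_eq_integral_abs mu measurableT (measurable_fun_ysection mu mM).
have [[y ye nPy]|noy] := pselect (exists2 y, 0 < y < e & ~ P y).
  exists y => //; exists (ysection M y); split.
  - exact: measurable_ysection.
  - by apply: contrapT => h; apply: nPy; apply: PS => /= /(_ I).
  - by move=> x /ysectionP /NM/ysectionP.
have sub : `]0, e[%classic `<=` P.
  move=> y; rewrite /= in_itv/= => ye; apply: contrapT => nPy; apply: noy.
  by exists y.
have : (mu `]0%R, e[%classic <= mu P)%E by apply: le_measure => //; rewrite inE.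
rewrite P0 lebesgue_measure_itv/= lte_fin e0 sube0 lee_fin.
by rewrite leNgt e0.
Qed.

End NullSections.

Section Gronwall.
Variable R : realType.
Local Notation mu := (@lebesgue_measure R).

(** Multiply phi by exp (- K x) for the first inequality, by exp (K x) for the second. *)
Lemma ae_gronwall (phi dphi : R -> R) (K a b : R) : a <= b ->
  (forall x, a <= x <= b -> is_derive x 1 phi (dphi x)) ->
  mu.-negligible [set x | a <= x <= b /\ K * phi x < `|dphi x|] ->
  phi b <= phi a * expR (K * (b - a)) /\ phi a <= phi b * expR (K * (b - a)).
Proof.
move=> ab dP N0.
have dE (c x : R) : is_derive x 1 (fun t : R => expR (c * t)) (c * expR (c * x)).
  have d1 : is_derive x 1 (fun t : R => c * t) c.
    by apply: is_derive_eq; rewrite /= ?scaler1 ?mulr1 ?mulr0 ?addr0 /GRing.scale/= ?mulr1.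
  have d2 : is_derive (c * x) 1 (@expR R) (expR (c * x)) by exact: is_derive_expR.
  have := @is_derive1_comp _ (@expR R) (fun t => c * t) x _ _ d2 d1.
  by rewrite mulrC.
have dM (c x : R) : a <= x <= b ->
    is_derive x 1 (fun t : R => phi t * expR (c * t)) ((dphi x + c * phi x) * expR (c * x)).
  move=> xab; have := @is_deriveM _ _ phi (fun t : R => expR (c * t)) x 1 _ _ (dP x xab) (dE c x).
    by move=> h; apply: (is_derive_eq h); rewrite /GRing.scale/=; ring.
split.
- have := @ae_derive_le0 _ (fun t : R => phi t * expR (- K * t))
    (fun x => (dphi x + - K * phi x) * expR (- K * x)) a b ab (dM (- K)).
  have sub : mu.-negligible [set x | a <= x <= b /\ 0 < (dphi x + - K * phi x) * expR (- K * x)].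
    apply: negligibleS N0 => x [xab]; rewrite pmulr_lgt0 ?expR_gt0// mulNr subr_gt0 => h.
    by split=> //; apply: (lt_le_trans h); exact: ler_norm.
  move=> /(_ sub); rewrite -ler_pdivlMr ?expR_gt0// => h.
  apply: (le_trans h); rewrite -expRN -mulrA -expRD.
  by rewrite (_ : - K * a - - K * b = K * (b - a))//; ring.
- have := @ae_derive_le0 _ (fun t : R => - (phi t * expR (K * t)))
    (fun x => - ((dphi x + K * phi x) * expR (K * x))) a b ab
    (fun x xab => @is_deriveN _ _ _ _ _ _ _ (dM K x xab)).
  have sub : mu.-negligible [set x | a <= x <= b /\ 0 < - ((dphi x + K * phi x) * expR (K * x))].
    apply: negligibleS N0 => x [xab]; rewrite -mulNr pmulr_lgt0 ?expR_gt0// oppr_gt0 => h.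
    split=> //; have := ler_norm (- dphi x); rewrite normrN; lra.
  move=> /(_ sub); rewrite lerN2 -ler_pdivlMr ?expR_gt0// => h.
  apply: (le_trans h); rewrite -expRN -mulrA -expRD.
  by rewrite (_ : K * b - K * a = K * (b - a))//; ring.
Qed.

End Gronwall.

Section ModulusBounds.
Variable R : realType.
Local Open Scope complex_scope.
Local Notation C := (complex R).
Implicit Types (z p : C).

Lemma normc_ctrunc_exp k p : normc p <= 1 -> normc (ctrunc_exp k p) <= k.+1%:R.
Proof.
move=> p1; have pX n : normc (p ^+ n) <= 1.
  elim: n => [|n IHn]; first by rewrite expr0 normc1.
  by rewrite exprS normcM mulr_ile1 ?normc_ge0.
rewrite /ctrunc_exp -[k.+1 in leRHS]card_ord -sumr_const.
apply: (big_ind2 (fun (w : C) (x : R) => normc w <= x)) => [|w1 x1 w2 x2 h1 h2|n _].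
- by rewrite normc0.
- by apply: (le_trans (le_normcD _ _)); exact: lerD.
- have -> : (n`!%:R)^-1 = (n`!%:R^-1)%:C :> C by rewrite fmorphV rmorph_nat.
  have f1 : 1 <= n`!%:R :> R by rewrite ler1n fact_gt0.
  rewrite normcM normc_real ger0_norm ?invr_ge0// mulr_ile1 ?invr_ge0 ?normc_ge0//.
  by rewrite invf_le1// (lt_le_trans ltr01).
Qed.

Lemma normc_ek_pow' (alpha : R) k z : 0 <= alpha -> 0 < normc z <= 1 ->
  normc (ek_pow' alpha k z) <= k.-1.+1%:R * (alpha / normc z).
Proof.
move=> a0 z01; have z0 : 0 < normc z by case/andP: z01.
have p1 : normc (cpow alpha z) <= 1.
  by rewrite normc_cpow -(powRr0 (normc z)) ger_powR.
rewrite /ek_pow'; move: (cpow alpha z) p1 => p p1.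
rewrite normcM ler_pM ?normc_ge0 ?normc_ctrunc_exp// !normcM normcV normc_real ger0_norm//.
by rewrite ler_wpM2r ?invr_ge0 ?normc_ge0// ler_piMr.
Qed.

End ModulusBounds.

Section SlitDisc.
Variable R : realType.
Local Open Scope complex_scope.
Local Notation C := (complex R).
Local Notation Re := (@complex.Re R).
Local Notation Im := (@complex.Im R).
Implicit Types (z w : C).

Lemma slitdisc_near_half w : normc (w - (2^-1)%:C) < 4^-1 -> slitdisc w /\ 4^-1 < Re w.
Proof.
move=> w4; have hR := le_lt_trans (normr_Re _) w4.
have rw : 4^-1 < Re w by move: hR; rewrite ReB/= ltr_norml => /andP[]; lra.
split=> //; split; last by right; lra.
have := le_normcD (w - (2^-1)%:C) (2^-1)%:C; rewrite subrK normc_real gtr0_norm ?invr_gt0//; lra.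
Qed.

Lemma slitdisc_starlike z (t : R) : slitdisc z -> 0 <= t <= 1 ->
  slitdisc ((2^-1)%:C + t%:C * (z - (2^-1)%:C)).
Proof.
move=> [z1 zs] /andP[t0 t1].
have E : (2^-1)%:C + t%:C * (z - (2^-1)%:C) = (2^-1 * (1 - t))%:C + t%:C * z.
  by apply/eqP; rewrite eq_complex; case: z {z1 zs} => a b /=; apply/andP; split; apply/eqP; ring.
split.
  rewrite E; apply: (le_lt_trans (le_normcD _ _)).
  rewrite normcM !normc_real (ger0_norm t0) ger0_norm; last by rewrite mulr_ge0//; lra.
  by have := normc_ge0 z; nra.
have -> : slitplane ((2^-1)%:C + t%:C * (z - (2^-1)%:C)) <->
    t * Im z != 0 \/ 0 < 2^-1 * (1 - t) + t * Re z.
  rewrite E /slitplane; case: z {z1 zs E} => a b /=.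
  by rewrite !mul0r subr0 addr0 add0r.
have [t00|tn] := eqVneq t 0; first by right; rewrite t00; lra.
have tp : 0 < t by rewrite lt_neqAle eq_sym tn.
by case: zs => [Iz|Rz]; [left; rewrite mulf_neq0|right; nra].
Qed.

End SlitDisc.

(** * The identity principle for slice regular functions *)

Section SliceComponent.
Variable R : realType.
Local Open Scope complex_scope.
Local Notation C := (complex R).
Local Notation H := (quat R).
Local Notation Re := (@complex.Re R).
Local Notation Im := (@complex.Im R).
Variables (J : H) (JS : imag_sphere R J) (r : H -> R).
Hypothesis rlin : forall a p q, r (a *: p + q) = a * r p + r q.
Hypothesis r_le : forall q, `|r q| <= `|q|.

(** A complex function on the quaternions that is linear for left multiplication by C(J), and
    whose real part is the given real functional. *)
Definition ccomp q : C := r q +i* - r (J * q).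

Lemma ccompM z q : ccomp (slice J z * q) = z * ccomp q.
Proof.
have J2 : J * J = -1 := imag_sphere_sqr JS.
have rN p : r (- p) = - r p.
  have := rlin (-1) p (0 : H); have := rlin 0 0 (0 : H); have := rlin (-1) 0 (0 : H).
  by rewrite !scaleN1r !addr0 !oppr0 !mul0r; lra.
have E : slice J z * q = Re z *: q + Im z *: (J * q).
  by rewrite /slice /slice_pt /= mulrDl -!scalerAl mul1r.
have r0 : r 0 = 0 by have := rlin 1 0 (0 : H); rewrite scaler0 addr0; lra.
have rZ a p : r (a *: p) = a * r p by have := rlin a p 0; rewrite addr0 r0 addr0.
rewrite /ccomp E mulrDr -!scalerAr mulrA J2 mulN1r !rlin !rZ rN.
by case: z {E} => a b /=; apply/eqP; rewrite eq_complex /=; apply/andP; split; apply/eqP; ring.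
Qed.

Lemma ccompB p q : ccomp (p - q) = ccomp p - ccomp q.
Proof.
have rB p' q' : r (p' - q') = r p' - r q'.
  have := rlin (-1) q' p'; rewrite scaleN1r addrC => ->; lra.
rewrite /ccomp mulrBr !rB; apply/eqP; rewrite eq_complex /=.
by apply/andP; split; apply/eqP; ring.
Qed.

Lemma normc_ccomp q : normc (ccomp q) <= 2 * `|q|.
Proof.
have [_ J1] := JS.
apply: (le_trans (normc_le _)); rewrite /= normrN mulr_natl mulr2n lerD//.
by apply: (le_trans (r_le _)); rewrite quat_normM J1 mul1r.
Qed.

Lemma sderiv_cdifferentiable g z D : is_sderiv J g z D -> cdifferentiable (fun w => ccomp (g w)) z.
Proof.
move=> gD; exists (ccomp D) => e e0.
have [d d0 dP] := gD (e / 2) ltac:(by rewrite divr_gt0).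
exists d => // w /dP h.
rewrite mulrC -ccompM -!ccompB.
apply: (le_trans (normc_ccomp _)).
by rewrite mulrC -ler_pdivlMr// mulrAC.
Qed.

End SliceComponent.

Section Identity.
Variable R : realType.
Local Open Scope complex_scope.
Local Notation C := (complex R).
Local Notation H := (quat R).
Variable f : Efun R.
Hypothesis fr : slice_regular f.
Hypothesis f0 : forall x : R, `|x - 2^-1| < 4^-1 -> Eext f x%:A = 0.

(** The component is holomorphic on the slit disc, which is starlike with respect to 1/2. *)
Lemma ccomp_eq0 (J : H) (r : H -> R) z : imag_sphere R J ->
  (forall a p q, r (a *: p + q) = a * r p + r q) -> (forall q, `|r q| <= `|q|) ->
  slitdisc z -> r (Eext f (slice J z)) = 0.
Proof.
move=> JS rlin r_le zd.
pose F w := ccomp J r (Eext f (slice J w)).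
have Fd w : slitdisc w -> cdifferentiable F w.
  by move=> /(sderP JS fr); exact: sderiv_cdifferentiable.
have r0 : r 0 = 0 by have := rlin 1 0 0; rewrite scaler0 addr0; lra.
suff : F z = 0 by move=> /(congr1 (@complex.Re R)).
apply: (@segment_unique _ F (2^-1)%:C).
  move=> t t01; have [d d0 dP] := slitdisc_open (slitdisc_starlike zd t01).
  by exists d => // w /dP/Fd.
exists (4^-1 / 4); first by rewrite divr_gt0.
apply: real_interval_unique => [w /slitdisc_near_half[wd _]|x x4]; first exact: Fd.
by rewrite /F slice_real f0// /ccomp mulr0 r0 oppr0.
Qed.

(** Every point of E lies in some plane C(J), where the four real components vanish by
    [ccomp_eq0]. *)
Lemma slice_regular_eq0 : f = 0.
Proof.
apply/funext => x; rewrite -EextE.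
set q := set_val x; have qE : Edom R q by exact: set_valP.
have [JS qJ] := imag_unitP q; set J := imag_unit q in JS qJ.
have qz : q = slice J (qr q +i* `|imag q|) by [].
have zd : slitdisc (qr q +i* `|imag q|) by apply/(Edom_slice JS); rewrite -qz.
rewrite {1}qz; apply: quatP.
- by apply: (ccomp_eq0 JS _ _ zd) => // p; exact: quat_qr_le.
- by apply: (ccomp_eq0 JS _ _ zd) => // p; exact: quat_qi_le.
- by apply: (ccomp_eq0 JS _ _ zd) => // p; exact: quat_qj_le.
- by apply: (ccomp_eq0 JS _ _ zd) => // p; exact: quat_qk_le.
Qed.

End Identity.

(** * Functions with vanishing fractional derivative *)

Section RealVanishing.
Variable R : realType.
Local Open Scope complex_scope.
Local Notation C := (complex R).
Local Notation H := (quat R).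
Local Notation mu := (@lebesgue_measure R).
Variables (I : H) (IS : imag_sphere R I) (alpha sigma : R) (k : nat) (f : Efun R).
Hypotheses (alpha_gt0 : 0 < alpha) (sigma_gt0 : 0 < sigma) (sigma_lt1 : sigma < 1).
Hypothesis k_ge1 : (1 <= k)%N.
Hypothesis ek_neq0 : forall q : H, Edom R q -> trunc_exp k.-1 (qpow alpha q) <> 0.
Hypothesis fr : slice_regular f.
Local Notation F := (fun z => Eext f (slice I z)).
Local Notation frac v := (frac_deriv sigma alpha k I f (slice_pt I v)).

Lemma is_derive_component (r : H -> R) (x y : R) :
  (forall a p q, r (a *: p + q) = a * r p + r q) -> (forall q, `|r q| <= `|q|) ->
  slitdisc (pt (x, y)) ->
  is_derive x 1 (fun t : R => r (F (pt (t, y)))) (r (sder I f (pt (x, y)))).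
Proof.
move=> rlin r_le zd; apply: is_derive_approx => e e0.
have [d d0 dP] := sderP IS fr zd e0; exists d => // t tx.
have tE : pt (t, y) - pt (x, y) = (t - x)%:C.
  by apply/eqP; rewrite eq_complex /=; apply/andP; split; apply/eqP; ring.
have nt : normc (pt (t, y) - pt (x, y)) = `|t - x| by rewrite tE normc_real.
have := dP (pt (t, y)); rewrite nt => /(_ tx); apply: le_trans.
rewrite tE slice_real -[_%:A * _]scalerAl mul1r.
have rB p q : r (p - q) = r p - r q.
  have := rlin (-1) q p; rewrite scaleN1r addrC => ->; lra.
have rZ a p : r (a *: p) = a * r p.
  by have := rlin a p 0; have := rlin 1 0 0; rewrite scale1r addr0 => h; rewrite addr0 => ->; lra.
by rewrite -rZ -!rB.
Qed.

Lemma is_derive_sqr_norm (x y : R) : slitdisc (pt (x, y)) ->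
  is_derive x 1 (fun t : R => `|F (pt (t, y))| ^+ 2)
    (2 * qdot (F (pt (x, y))) (sder I f (pt (x, y)))).
Proof.
move=> zd.
have sq (h : R -> R) (D : R) : is_derive x 1 h D -> is_derive x 1 (fun t => h t * h t) (2 * (h x * D)).
  move=> hD; have := @is_deriveM _ _ h h x 1 _ _ hD hD.
  by move=> h'; apply: (is_derive_eq h'); rewrite /GRing.scale/=; ring.
have d1 := sq _ _ (@is_derive_component (@qr R) x y (fun _ _ _ => erefl) (@quat_qr_le R) zd).
have d2 := sq _ _ (@is_derive_component (@qi R) x y (fun _ _ _ => erefl) (@quat_qi_le R) zd).
have d3 := sq _ _ (@is_derive_component (@qj R) x y (fun _ _ _ => erefl) (@quat_qj_le R) zd).
have d4 := sq _ _ (@is_derive_component (@qk R) x y (fun _ _ _ => erefl) (@quat_qk_le R) zd).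
have D4 := is_deriveD (is_deriveD (is_deriveD d1 d2) d3) d4.
rewrite -!mulrDr in D4; rewrite (_ : (fun t : R => `|F (pt (t, y))| ^+ 2) = (fun t =>
    qr (F (pt (t, y))) * qr (F (pt (t, y))) + qi (F (pt (t, y))) * qi (F (pt (t, y))) +
    qj (F (pt (t, y))) * qj (F (pt (t, y))) + qk (F (pt (t, y))) * qk (F (pt (t, y))))).
  exact: D4.
by apply/funext => t; rewrite quat_sqr_norm.
Qed.

(** A bound on Re z >= 1/4 for the modulus of (1 - sigma) / sigma times the derivative of
    e_k (z^alpha). *)
Definition sder_ratio : R := sigma^-1 * (k.-1.+1%:R * (alpha * 4)).

Lemma sder_ratio_ge0 : 0 <= sder_ratio.
Proof. by rewrite !mulr_ge0 ?invr_ge0 ?(ltW sigma_gt0) ?(ltW alpha_gt0). Qed.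

(** A vanishing fractional derivative is a first order differential equation for f. *)
Lemma sder_le (x y : R) : slitdisc (pt (x, y)) -> 4^-1 <= x -> frac (x, y) = 0 ->
  `|sder I f (pt (x, y))| <= sder_ratio * `|F (pt (x, y))|.
Proof.
move=> zd x4 fz; have vA : slice_region I (x, y) by apply/(slice_regionP IS).
have := frac_derivE IS alpha_gt0 k_ge1 ek_neq0 sigma fr vA; rewrite fz => /esym/eqP.
have E0 := ek_pow'_neq0 IS alpha_gt0 ek_neq0 zd.
set z := pt (x, y) in zd E0 *.
have nz : 4^-1 <= normc z by apply: (le_trans x4); apply: le_trans (normr_Re z); exact: ler_norm.
have Eb : normc (ek_pow' alpha k z) <= k.-1.+1%:R * (alpha * 4).
  apply: (le_trans (normc_ek_pow' _ (ltW alpha_gt0) _)).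
    by rewrite (lt_le_trans _ nz) ?invr_gt0//=; case: zd => /ltW.
  by rewrite ler_wpM2l// ler_wpM2l ?(ltW alpha_gt0)// invf_ple ?posrE// (lt_le_trans _ nz) ?invr_gt0.
rewrite addr_eq0 => /eqP /(congr1 Num.norm).
have n0 : 0 < normc (ek_pow' alpha k z) by rewrite normc_gt0.
rewrite normrN !normrZ quat_normM quat_normV (slice_norm IS) (gtr0_norm sigma_gt0) (@ger0_norm _ (1 - sigma));
  last by rewrite subr_ge0 ltW.
move: (`|Eext f _|) (normr_ge0 (Eext f (slice I z))) (`|sder _ _ _|) (normr_ge0 (sder I f z)).
move=> a a0 b b0 ab; rewrite /sder_ratio -mulrA ler_pdivlMl//.
have -> : sigma * b = (1 - sigma) * a * normc (ek_pow' alpha k z).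
  by rewrite ab; field; rewrite gt_eqF.
rewrite mulrAC mulrC (mulrC _ a) ler_wpM2l//.
by apply: le_trans Eb; rewrite ler_piMl ?(ltW n0)// lerBlDr lerDl ltW.
Qed.

Hypothesis frac0_ae : (mu \x mu)%E.-negligible [set v | slice_region I v /\ frac v <> 0].
Hypothesis f_half : Eext f (2^-1)%:A = 0.

Lemma slitdisc_pt (x y : R) : `|x - 2^-1| < 4^-1 -> 0 <= y < 4^-1 ->
  slitdisc (pt (x, y)) /\ 4^-1 <= x.
Proof.
rewrite ltr_norml => /andP[x1 x2] /andP[y1 y2]; have x0 : 0 < x by lra.
split; last lra; split; last by right.
by apply: (le_lt_trans (normc_le _)); rewrite /= ger0_norm ?(ltW x0)// ger0_norm//; lra.
Qed.

(** Gronwall between 1/2 and x, in either direction, as the derivative of |f|^2 is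
    2 <f, f'>, of modulus at most |f|^2 + |f'|^2. *)
Lemma line_estimate (x y : R) : `|x - 2^-1| < 4^-1 -> 0 < y < 4^-1 ->
  mu.-negligible (ysection [set v | slice_region I v /\ frac v <> 0] y) ->
  `|F (pt (x, y))| ^+ 2 <= `|F (pt (2^-1, y))| ^+ 2 * expR (1 + sder_ratio ^+ 2).
Proof.
move=> x4 /andP[y0 y4] Ny.
pose K := 1 + sder_ratio ^+ 2; have K0 : 0 <= K by rewrite addr_ge0// sqr_ge0.
have y04 : 0 <= y < 4^-1 by rewrite (ltW y0).
have half4 : `|2^-1 - 2^-1 : R| < 4^-1 by rewrite subrr normr0 invr_gt0.
have between (a b t : R) : `|a - 2^-1| < 4^-1 -> `|b - 2^-1| < 4^-1 -> a <= t <= b ->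
    `|t - 2^-1| < 4^-1 by rewrite !ltr_norml; lra.
have est (a b : R) : `|a - 2^-1| < 4^-1 -> `|b - 2^-1| < 4^-1 -> a <= b ->
    `|F (pt (b, y))| ^+ 2 <= `|F (pt (a, y))| ^+ 2 * expR (K * (b - a)) /\
    `|F (pt (a, y))| ^+ 2 <= `|F (pt (b, y))| ^+ 2 * expR (K * (b - a)).
  move=> a4 b4 ab.
  apply: (@ae_gronwall _ (fun t => `|F (pt (t, y))| ^+ 2)
    (fun t => 2 * qdot (F (pt (t, y))) (sder I f (pt (t, y)))) K a b ab).
    move=> t abt; apply: is_derive_sqr_norm.
    by have [] := slitdisc_pt (between _ _ _ a4 b4 abt) y04.
  apply: negligibleS Ny => t [abt bad]; apply/ysectionP.
  have [zd t4] := slitdisc_pt (between _ _ _ a4 b4 abt) y04.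
  split; first exact/(slice_regionP IS).
  move=> fz; have := sder_le zd t4 fz => h.
  move: bad; apply/negP; rewrite -leNgt; apply: (le_trans (qdot_le _ _)).
  by rewrite mulrDl mul1r lerD2l -exprMn ler_pXn2r ?nnegrE// mulr_ge0 ?sder_ratio_ge0.
have fin (u v s : R) : 0 <= v -> `|s| <= 1 -> u <= v * expR (K * s) -> u <= v * expR K.
  move=> v0 s1 /le_trans; apply; rewrite ler_wpM2l// ler_expR -[leRHS]mulr1 ler_wpM2l//.
  by apply: le_trans s1; exact: ler_norm.
have quarter : 4^-1 <= 1 :> R by rewrite invf_le1// ler1n.
have [xh|xh] := leP x 2^-1.
  have [_ h] := est _ _ x4 half4 xh; apply: fin h; first exact: sqr_ge0.
  by rewrite distrC; apply: (le_trans (ltW x4) quarter).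
have [h _] := est _ _ half4 x4 (ltW xh); apply: fin h; first exact: sqr_ge0.
by apply: (le_trans (ltW x4) quarter).
Qed.

(** The estimate passes to the limit along horizontal lines tending to the real axis. *)
Lemma real_vanishing (x : R) : `|x - 2^-1| < 4^-1 -> Eext f x%:A = 0.
Proof.
move=> x4; have realpt (t : R) : pt (t, 0) = t%:C by [].
have FE (t : R) : F (pt (t, 0)) = Eext f t%:A by rewrite realpt slice_real.
have y00 : 0 <= (0 : R) < 4^-1 by rewrite lexx invr_gt0 ltr0n.
have half4 : `|2^-1 - 2^-1 : R| < 4^-1 by rewrite subrr normr0 invr_gt0.
have [zx _] := slitdisc_pt x4 y00; have [zh _] := slitdisc_pt half4 y00.
apply/eqP/negPn/negP => Fx; rewrite -normr_gt0 in Fx.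
pose M := expR (1 + sder_ratio ^+ 2); have M0 : 0 < M by exact: expR_gt0.
pose n := `|Eext f x%:A|.
have [d1 d10 d1P] := sderiv_cvg IS (sderP IS fr zx) (e := n / 2) ltac:(by rewrite divr_gt0).
(* At a small height y the moduli A over x and B over 1/2 satisfy A > n / 2,
   B (1 + M) < n / 2 and A^2 <= B^2 M, which is absurd. *)
have e20 : 0 < n / 2 / (1 + M) by rewrite divr_gt0 ?divr_gt0// addr_gt0.
have [d2 d20 d2P] := sderiv_cvg IS (sderP IS fr zh) e20.
have m0 : 0 < Num.min 4^-1 (Num.min d1 d2) by rewrite !lt_min invr_gt0 d10 d20 ltr0n.
have [y /andP[y0 ym] Ny] := null_sections frac0_ae m0.
move: ym; rewrite !lt_min => /and3P[y4 yd1 yd2].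
have ny (t : R) : normc (pt (t, y) - pt (t, 0)) = y.
  rewrite (_ : _ - _ = 'i * y%:C).
    by rewrite normcM normc_real gtr0_norm//= expr0n expr1n add0r sqrtr1 mul1r.
  by apply/eqP; rewrite eq_complex /=; apply/andP; split; apply/eqP; ring.
have := d1P (pt (x, y)); rewrite ny => /(_ yd1) h1.
have := d2P (pt (2^-1, y)); rewrite ny => /(_ yd2).
rewrite !FE f_half subr0 in h1 * => h2.
have := line_estimate x4 _ Ny; rewrite y0 y4 => /(_ isT); rewrite -/M.
move: h1; rewrite -/n.
have h3 : n - `|F (pt (x, y))| <= `|F (pt (x, y)) - Eext f x%:A|.
  by rewrite distrC; exact: lerB_dist.
move: h2 h3; have B0 := normr_ge0 (F (pt (2^-1, y))); have A0 := normr_ge0 (F (pt (x, y))).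
move: (`|F (pt (2^-1, y))|) (`|F (pt (x, y))|) (`|_ - _|) B0 A0 => B A D B0 A0.
rewrite ltr_pdivlMr ?addr_gt0// => h2 h3 h1 h4.
have h5 : A <= B * (1 + M).
  rewrite -(@ler_pXn2r _ 2) ?nnegrE//; last by rewrite mulr_ge0// addr_ge0// ltW.
  apply: (le_trans h4); rewrite exprMn ler_wpM2l ?sqr_ge0// sqrrD expr1n mul1r; nra.
by lra.
Qed.

End RealVanishing.

(** * The normed right module *)

Section Definiteness.
Variable R : realType.
Local Notation H := (quat R).
Local Notation mu2 := ((@lebesgue_measure R) \x (@lebesgue_measure R))%E.
Variables (I : H) (IS : imag_sphere R I) (sigma alpha : R) (k : nat).
Hypotheses (alpha_gt0 : 0 < alpha) (sigma_gt0 : 0 < sigma) (sigma_lt1 : sigma < 1).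
Hypothesis k_ge1 : (1 <= k)%N.
Hypothesis ek_neq0 : forall q : H, Edom R q -> trunc_exp k.-1 (qpow alpha q) <> 0.

Lemma energy_eq0 f : slice_regular f -> energy I sigma alpha k f = 0%E ->
  mu2.-negligible [set v | slice_region I v /\ frac_deriv sigma alpha k I f (slice_pt I v) <> 0].
Proof.
move=> fr E0; have mA := measurable_region IS.
have mf := density_measurable IS sigma alpha_gt0 k_ge1 ek_neq0 fr.
have E1 : (\int[mu2]_(v in slice_region I)
    `|(`|frac_deriv sigma alpha k I f (slice_pt I v)| ^+ 2)%:E|)%E = 0%E.
  rewrite -[RHS]E0; apply: eq_integral => v _.
  by rewrite gee0_abs// lee_fin sqr_ge0.
have [/(_ E1) ae0 _] := ae_eq_integral_abs mu2 mA mf.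
apply: negligibleS ae0 => v [vA nz] /= h; apply: nz; move: (h vA) => [] /eqP.
by rewrite sqrf_eq0 normr_eq0 => /eqP.
Qed.

Lemma Dnorm_eq0 f : Dspace sigma alpha k I f -> Dnorm sigma alpha k I f = 0 -> f = 0.
Proof.
move=> [fr foo] /eqP; rewrite /Dnorm sqrtr_eq0 => sq0.
have D0 : Dsqnorm sigma alpha k I f = 0%E.
  rewrite (Dspace_fin_num alpha_gt0 foo); congr EFin; apply/eqP.
  by rewrite eq_le sq0 fine_ge0_sqn.
have [P0 E0] : alpha * `|Eext f (2^-1)%:A| ^+ 2 = 0 /\ energy I sigma alpha k f = 0%E.
  have p0 := point_ge0 alpha_gt0 f; have e0 := energy_ge0 I sigma alpha k f.
  move: D0; rewrite DsqnormE => /eqP; rewrite padde_eq0 ?lee_fin//.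
  by move=> /andP[/eqP[->] /eqP ->].
have f_half : Eext f (2^-1)%:A = 0.
  by move/eqP: P0; rewrite mulf_eq0 gt_eqF//= sqrf_eq0 normr_eq0 => /eqP.
apply: (slice_regular_eq0 fr) => x x4.
exact: (real_vanishing IS alpha_gt0 sigma_gt0 sigma_lt1 k_ge1 ek_neq0 fr (energy_eq0 fr E0) f_half).
Qed.

End Definiteness.

Unset Implicit Arguments.
Set Strict Implicit.
Set Printing Implicit Defensive.

Theorem proposition5p9 (R : realType) (alpha sigma : R) (k : nat) (i : quat R)
  (alpha_itv : 0 < alpha <= 1) (sigma_itv : 0 < sigma < 1) (k_ge1 : (1 <= k)%N)
  (ek_neq0 : forall q : quat R, Edom R q -> trunc_exp k.-1 (qpow alpha q) <> 0)
  (i_unit : imag_sphere R i) :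
  normed_right_module (Dspace sigma alpha k i) (Dnorm sigma alpha k i).
Proof.
have [alpha_gt0 _] := andP alpha_itv; have [sigma_gt0 sigma_lt1] := andP sigma_itv.
split=> [|f _|f|f c|f g].
- split=> [|c f g /set_mem fD /set_mem gD]; apply/mem_set; last exact: Dspace_closed.
  split; first exact: slice_regular0.
  by rewrite (Dsqnorm0 i_unit sigma alpha_gt0 k_ge1 ek_neq0) ltry.
- exact: sqrtr_ge0.
- exact: Dnorm_eq0.
- exact: Dnorm_scale.
- exact: Dnorm_triangle.
Qed.
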